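(* For every $k,d\in\mathbb N$ there exists $\epsilon>0$ such that for every polynomial $$P(n)=\sum_{\gamma\in\mathbb N_0^k:\,0<|\gamma|\le d}\xi_\gamma n^\gamma$$ with real coefficients $\xi_\gamma$, every $N>1$, every convex set $\Omega\subseteq B(0,N)\subset\mathbb R^k$, every function $\phi:\Omega\cap\mathbb Z^k\to\mathbb C$, every multi-index $\gamma_0\in\mathbb N_0^k$ with $0<|\gamma_0|\le d$, and all integers $0\le a<q$ with $(a,q)=1$ and $$\Big|\xi_{\gamma_0}-\frac aq\Big|\le\frac1{q^2},$$ we have $$\Big|\sum_{n\in\Omega\cap\mathbb Z^k}e(P(n))\phi(n)\Big|\lesssim_{d,k}N^k\kappa^{-\epsilon}\log(N+1)\,\|\phi\|_{L^\infty(\Omega)}+N^k\sup_{|x-y|\le N\kappa^{-\epsilon}}|\phi(x)-\phi(y)|,$$ where $$\kappa=\min\{q,N^{|\gamma_0|}/q\}.$$ The implicit constant depends only on $d,k$ and is independent of the coefficients of $P$ and the numbers $a$, $q$ and $N$.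
   Context: $e(y)=e^{2\pi iy}$; $n^\gamma=n_1^{\gamma_1}\cdots n_k^{\gamma_k}$, $|\gamma|=\gamma_1+\dots+\gamma_k$; $B(0,N)$ is the open Euclidean ball. $\|\phi\|_{L^\infty(\Omega)}=\sup_{x\in\Omega\cap\mathbb Z^k}|\phi(x)|$, and the last supremum is over $x,y\in\Omega\cap\mathbb Z^k$ with $|x-y|\le N\kappa^{-\epsilon}$. *)

(* Defs.v *)
From HB Require Import structures.
From mathcomp Require Import all_boot all_order all_algebra.
From mathcomp Require Import complex.
From mathcomp Require Import all_classical all_reals all_analysis.

Set Implicit Arguments.
Unset Strict Implicit.
Unset Printing Implicit Defensive.
Import Order.TTheory GRing.Theory Num.Theory.
Import numFieldNormedType.Exports.
Export ComplexField.Normc.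

Local Open Scope classical_set_scope.
Local Open Scope ring_scope.

Section WeylSums.
Context {R : realType} {k : nat}.

(* e(y) = exp(2 pi i y) *)
Definition expi (y : R) : R[i] := (cos (2 * pi * y) +i* sin (2 * pi * y))%C.

(* The canonical norm `|x| on 'rV[R]_k is the sup norm, hence this one. *)
Definition enorm (x : 'rV[R]_k) : R := Num.sqrt (\sum_(i < k) x 0 i ^+ 2).

Definition eball (r : R) : set 'rV[R]_k := [set x | enorm x < r].

Definition realvec (n : 'rV[int]_k) : 'rV[R]_k := map_mx intr n.

Definition lattice_points (Omega : set 'rV[R]_k) : set 'rV[int]_k :=
  realvec @^-1` Omega.

(* Multi-indices in N_0^k are row vectors of natural numbers. *)
Definition mdeg (g : 'rV[nat]_k) : nat := (\sum_(i < k) g ord0 i)%N.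

Definition monomial (g : 'rV[nat]_k) (n : 'rV[int]_k) : R :=
  \prod_(i < k) (n 0 i)%:~R ^+ g 0 i.

(* Only the finitely many xi g with 0 < |g| <= d matter. *)
Definition polyfun (d : nat) (xi : 'rV[nat]_k -> R) (n : 'rV[int]_k) : R :=
  \sum_(g \in [set g : 'rV[nat]_k | (0 < mdeg g <= d)%N]) xi g * monomial g n.

(* The two suprema below are those of finite sets when Omega is bounded, and
   are 0 (sup set0 = 0) when Omega contains no lattice point. A function on
   the lattice points of Omega is represented by any extension to Z^k. *)
Definition supnorm (Omega : set 'rV[R]_k) (phi : 'rV[int]_k -> R[i]) : R :=
  sup [set normc (phi x) | x in lattice_points Omega].

Definition oscillation (Omega : set 'rV[R]_k) (phi : 'rV[int]_k -> R[i])
    (r : R) : R :=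
  sup [set z | exists x y, [/\ lattice_points Omega x, lattice_points Omega y,
    enorm (realvec x - realvec y) <= r & z = normc (phi x - phi y)]].

End WeylSums.

(* Main.v *)
Require Import Defs.
From mathcomp Require Import all_boot all_order all_algebra.
From mathcomp Require Import complex.
From mathcomp Require Import all_classical all_reals all_analysis.
From mathcomp Require Import ring lra zify.
Set Implicit Arguments.
Unset Strict Implicit.
Unset Printing Implicit Defensive.
Import Order.TTheory GRing.Theory Num.Theory.
Import numFieldNormedType.Exports.
Local Open Scope classical_set_scope.
Local Open Scope ring_scope.

(** The theorem follows from an inverse statement without the weight [phi]. Let
    [K >= 2] be an integer. If the sum of [expi (P n)] over the lattice points
    of a convex subset of the box [[-N, N]^k] exceeds the number of
    points of the box divided by [K], then some [q' <= K ^ A] makes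
    [q' * xi gamma0] differ from an integer by at most
    [K ^ A / N ^ mdeg gamma0], where [A] depends on [k] and [d] only
    ([weyl_box]). Comparing the resulting rational approximation of
    [xi gamma0] with [a / q] shows that [kappa <= 2 * K ^ A]
    ([weyl_denominator]); thus the sum saves a small power of [kappa]. The
    weight is handled by cutting the domain into cells of diameter
    [N * kappa `^ (- eps)], on which [phi] is replaced by a constant at the cost
    of its oscillation; the cells of a convex set are convex, and if [eps] is
    small the saving in each cell outweighs the number of cells
    ([cell_decomposition]).

    The inverse statement in one variable ([weyl_1d]) is proved by induction on
    the degree. Van der Corput differencing shows that for many shifts [h] the
    polynomial [p (X + h) - p] also has a large sum, so by induction its linear
    coefficient [p'(h) - p'(0)] is close to a rational with a small
    denominator. This is now a statement about the values of a polynomial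
    in [h] at many integers. A recurrence theorem ([recurrence_poly]), proved
    by the same kind of differencing but without any exponential sum, deduces
    that its coefficients, that is those of [p] of index at least 2, are close
    to rationals with a common small denominator [Q]. Along
    short progressions of step [Q] the phase is then almost linear, and a
    geometric sum controls the last coefficient ([weyl_sum_linear_coef]).

    In several variables, one slices in a direction that occurs in the
    monomial [gamma0]; by convexity the slices are intervals. The coefficient of
    the appropriate power is a polynomial in the remaining variables that is
    close to rationals at many points, and [recurrence_poly] is applied to one
    variable after the other ([eliminate_all]) until only [xi gamma0] is left.

    Throughout, [K] is the inverse of a density, all losses are powers of [K],
    and a denominator that depends on a point is made constant on a large set of
    points by the pigeonhole principle ([common_witness]). *)

(** * Counting and pigeonhole *)
Section Pigeonhole.

(** If the weights [w h <= X] have average at least [2 * c], those below [c]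
    contribute at most half of the total, so a proportion [c / X] of the [h]
    must have weight at least [c]. *)
Lemma popular_values (R : realFieldType) (T : Type) (H : seq T) (w : T -> R) (X c : R) :
  0 <= c -> (forall h, w h <= X) ->
  2 * c * (size H)%:R <= \sum_(h <- H) w h ->
  c * (size H)%:R <= X * (size [seq h <- H | c <= w h])%:R.
Proof.
move=> c0 wX Hw.
have : \sum_(h <- H) w h <= c * (size H)%:R + X * (size [seq h <- H | c <= w h])%:R.
  elim: H {Hw} => [|h H IH] /=; first by rewrite big_nil !mulr0 addr0.
  rewrite big_cons; have := wX h; case: (leP c (w h)) => hc /=.
    by rewrite -!natr1; lra.
  by rewrite -!natr1; lra.
by move: Hw; lra.
Qed.

(** Each [h] has a denominator [q <= Q]; the most frequent one serves a
    proportion [1 / Q] of the [h]. *)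
Lemma common_witness (T : eqType) (H : seq T) (Q : nat) (P : T -> nat -> Prop) :
  (0 < Q)%N ->
  (forall h, h \in H -> exists2 q, (0 < q <= Q)%N & P h q) ->
  exists2 q, (0 < q <= Q)%N & (size H <= Q * size [seq h <- H | `[< P h q >]])%N.
Proof.
move=> Q0 HP.
pose c q := size [seq h <- H | `[< P h q >]].
have sumc : (size H <= \sum_(1 <= q < Q.+1) c q)%N.
  rewrite {}/c; elim: H HP => [//|h H IH] HP /=.
  have /IH {}IH : forall h, h \in H -> exists2 q, (0 < q <= Q)%N & P h q.
    by move=> h' h'H; apply: HP; rewrite in_cons h'H orbT.
  have [q q1 Pq] := HP h (mem_head _ _).
  rewrite (eq_bigr (fun q => (`[< P h q >] : nat) +
      size [seq h <- H | `[< P h q >]])%N); last first.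
    by move=> i _; case: (`[< P h i >]).
  rewrite big_split /= -add1n leq_add //.
  rewrite (bigD1_seq q) ?mem_index_iota ?iota_uniq //=.
  by rewrite (introT (asboolP _) Pq) leq_addr.
have [/existsP [[q qQ] /= hq]|/existsPn hn] :=
  boolP [exists q : 'I_Q, (size H <= Q * c q.+1)%N].
  by exists q.+1.
have : (Q * \sum_(1 <= q < Q.+1) c q <= \sum_(1 <= q < Q.+1) (size H).-1)%N.
  rewrite big_distrr /= !big_add1 /= !big_mkord; apply: leq_sum => i _.
  by have := hn i; rewrite -ltnNge; case: (size H).
rewrite sum_nat_const_nat subn1 /= => le1.
have := leq_trans (leq_mul (leqnn Q) sumc) le1; rewrite leq_pmul2l // => s0.
by have := hn (Ordinal Q0); case: (size H) s0 => // n; rewrite ltnn.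
Qed.

(** Label [n] by the window of length [H] containing it and by its residue
    modulo [Q]. Two points with the same label differ by a multiple of [Q]
    smaller than [H]. Taking [Q = 1] gives two close points; a large [Q] keeps
    the two points at least [Q] apart. *)
Lemma congruent_pair (S : seq int) (N H Q : nat) :
  (0 < H)%N -> (0 < Q)%N -> uniq S -> {in S, forall n, `|n| <= N%:Z} ->
  (((2 * N) %/ H).+1 * Q < size S)%N ->
  exists n m : int, [/\ n \in S, n + m *+ Q \in S, 0 < m & m *+ Q < H%:Z].
Proof.
move=> H0 Q0 uS bS big.
pose f (n : int) := absz (n + N%:Z).
have fE n : n \in S -> (f n)%:Z = n + N%:Z.
  by move=> /bS; clear; rewrite /f; lia.
pose l n := (f n %/ H, f n %% Q)%N.
pose rng := [seq (i, j) | i <- iota 0 ((2 * N) %/ H).+1, j <- iota 0 Q].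
have /negP : ~~ uniq (map l S).
  apply/negP => ul; have : (size (map l S) <= size rng)%N.
    apply: uniq_leq_size => // _ /mapP [n nS ->].
    apply: allpairs_f; rewrite mem_iota /= add0n ?ltn_mod // ltnS.
    by apply: leq_div2r; move: (bS _ nS) (fE _ nS); clear; lia.
  by rewrite size_map size_allpairs !size_iota leqNgt big.
move=> nul; have {nul} : ~ {in S &, injective l}.
  by move=> inj; apply: nul; rewrite map_inj_in_uniq.
move=> /existsNP [x] /existsNP [y] /not_implyP [xS] /not_implyP [yS].
move=> /not_implyP [[e1 e2] xy].
wlog lt : x y xS yS e1 e2 xy / x < y.
  move=> W; case: (ltgtP x y) => [lt|lt|//]; first exact: (W x y).
  by apply: (W y x) => //; apply: nesym.
have fx := fE _ xS; have fy := fE _ yS.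
have lef : (f x <= f y)%N by rewrite -lez_nat fx fy lerD2r ltW.
have /dvdnP [m em] : (Q %| f y - f x)%N by rewrite -eqn_mod_dvd ?e2.
have mQ : (m%:Z *+ Q = y - x).
  by move: em lef fx fy; clear; rewrite -mulr_natr natz; lia.
exists x, m%:Z; rewrite mQ; split => //.
- by rewrite addrC subrK.
- by case: m mQ {em} => // /eqP; rewrite mul0rn eq_sym subr_eq0 => /eqP/nesym.
- have := ltn_ceil (f y) H0; have := leq_trunc_div (f x) H; rewrite e1 mulSn.
  by move: (_ * _)%N fx fy; clear; lia.
Qed.

End Pigeonhole.

(** As [K >= 2], a numerical constant in front of a power of [K] can be
    absorbed by raising the exponent. *)
Lemma leq_mul_expn2 (c a b K : nat) :
  (1 < K)%N -> (c <= 2 ^ (b - a))%N -> (a <= b)%N -> (c * K ^ a <= K ^ b)%N.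
Proof.
move=> K1 cab ab; rewrite -[b in leqRHS](subnK ab) expnD leq_mul2r.
by rewrite (leq_trans cab) ?orbT //; case: (b - a)%N => // n; rewrite leq_exp2r.
Qed.

Lemma leq_mul_expn (c a b K : nat) :
  (1 < K)%N -> (c + a <= b)%N -> (c * K ^ a <= K ^ b)%N.
Proof.
move=> K1 cab; apply: leq_mul_expn2 => //; last by apply: leq_trans cab; rewrite leq_addl.
have h : (c <= 2 ^ c)%N := ltnW (ltn_expl c (ltnSn 1)).
by apply: leq_trans h _; rewrite leq_exp2l //; move: cab; clear; lia.
Qed.

Lemma ler_mul_expn (R : realDomainType) (c a b K : nat) (e : R) :
  (1 < K)%N -> (c + a <= b)%N -> 0 <= e ->
  c%:R * (K%:R ^+ a * e) <= K%:R ^+ b * e.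
Proof.
move=> K1 cab e0; rewrite mulrA ler_wpM2r // -!natrX -natrM ler_nat.
exact: leq_mul_expn.
Qed.

(** * Approximation by integers *)
Section Nearint.
Context {R : realType}.
Implicit Types x y e : R.

(** The usual condition that the distance from [x] to the nearest integer is
    at most [e]. *)
Definition nearint x e := exists m : int, `|x - m%:~R| <= e.

Lemma nearint_le x e1 e2 : e1 <= e2 -> nearint x e1 -> nearint x e2.
Proof. by move=> le12 [m hm]; exists m; apply: le_trans le12. Qed.

Lemma nearint_ge0 x e : nearint x e -> 0 <= e.
Proof. by move=> [m]; apply: le_trans. Qed.

Lemma nearint1 x : nearint x 1.
Proof.
exists (Num.floor x); have := floor_le x; have := floorD1_gt x.
rewrite intrD1 => h1 h2; rewrite ger0_norm; lra.
Qed.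

Lemma nearintD x y e1 e2 :
  nearint x e1 -> nearint y e2 -> nearint (x + y) (e1 + e2).
Proof.
move=> [m hm] [n hn]; exists (m + n); rewrite intrD opprD addrACA.
exact: le_trans (ler_normD _ _) (lerD hm hn).
Qed.

Lemma nearintN x e : nearint x e -> nearint (- x) e.
Proof. by move=> [m hm]; exists (- m); rewrite intrN -opprD normrN. Qed.

Lemma nearintB x y e1 e2 :
  nearint x e1 -> nearint y e2 -> nearint (x - y) (e1 + e2).
Proof. by move=> hx hy; apply: nearintD => //; apply: nearintN. Qed.

Lemma nearintZ (z : int) x e :
  nearint x e -> nearint (z%:~R * x) (`|z%:~R| * e).
Proof.
move=> [m hm]; exists (z * m); rewrite intrM -mulrBr normrM.
by rewrite ler_wpM2l.
Qed.

Lemma nearintM (q : nat) x e : nearint x e -> nearint (q%:R * x) (q%:R * e).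
Proof.
by move=> /(nearintZ q%:Z); rewrite [`|_|]ger0_norm ?ler0z // -pmulrn.
Qed.

Lemma nearint_sum (I : Type) (r : seq I) (P : pred I) (f g : I -> R) :
  (forall i, P i -> nearint (f i) (g i)) ->
  nearint (\sum_(i <- r | P i) f i) (\sum_(i <- r | P i) g i).
Proof.
move=> H; elim/big_rec2: _ => [|i x y Pi IH].
  by exists 0; rewrite subr0 normr0.
by apply: nearintD => //; apply: H.
Qed.

End Nearint.

(** * Recurrence of linear functions *)
Section Linear.
Context {R : realType}.

(** If [al * n + be] is near an integer for a proportion [1 / K] of the [n] in
    [[-N, N]], two such [n] at distance [q < 4 * K] give
    [q * al = a + th] with [a] an integer and [`|th| <= 2 * e].  This does not
    yet involve [N]. To gain the factor [1 / N], look at a window of length [H]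
    on which multiples of [th] stay below [1 / 2]: there are two points whose
    difference is [q * t * j], with [q * t] comparable to [H / K], and since
    [j * t * th] is both small and near an integer it is at most [2 * e].  Hence
    [`|th|] is at most a power of [K] times [e / H]. If [H] were limited by the
    size of [th] rather than by [N], this would force [e] to be large. *)
Lemma recurrence_linear (K N : nat) (e al be : R) (S : seq int) :
  (1 < K)%N -> (K ^ 10 <= N)%N -> e * K%:R ^+ 10 <= 1 ->
  uniq S -> {in S, forall n, `|n| <= N%:Z} -> (N <= K * size S)%N ->
  {in S, forall n, nearint (al * n%:~R + be) e} ->
  exists2 q, (0 < q <= K ^ 10)%N & nearint (q%:R * al) (K%:R ^+ 10 * e / N%:R).
Proof.
move=> K1 KN eK uS bS dS nS.
have N1 : (0 < N)%N by apply: leq_trans KN; rewrite expn_gt0; lia.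
have nSd (n m : int) : n \in S -> n + m \in S -> nearint (m%:~R * al) (2 * e).
  move=> /nS h1 /nS h2; have := nearintB h2 h1.
  rewrite (_ : _ - _ = m%:~R * al); last by rewrite intrD; ring.
  by apply: nearint_le; lra.
have K0 : (0 < K)%N := ltnW K1.
have c1 : (16 * K ^ 2 <= N)%N.
  by apply: leq_trans KN; apply: leq_mul_expn2.
have c2 : (2 * K < N)%N.
  apply: leq_trans c1; rewrite -mulnn; clear -K1; nia.
have e0 : 0 <= e.
  case: S dS nS {uS bS nSd} => [|n S _ nS]; first by rewrite muln0; lia.
  exact: nearint_ge0 (nS n (mem_head _ _)).
have k2 : 2 <= K%:R :> R by rewrite ler_nat.
(* two points at distance less than 4 * K *)
have [n [m []]] : exists n m : int, [/\ n \in S, n + m *+ 1 \in S,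
    0 < m & m *+ 1 < (4 * K)%N%:Z].
  apply: (@congruent_pair S N); rewrite ?muln1 //; first by lia.
  have := leq_trunc_div (2 * N) (4 * K); move: (_ %/ _)%N => u hu.
  suff : (K * u.+1 < K * size S)%N by rewrite ltn_pmul2l.
  by apply: leq_trans dS; clear -hu c2; lia.
rewrite mulr1n => nin mnin m0 mK.
have [q qm] : exists q : nat, m = q%:Z by exists `|m|%N; rewrite gtz0_abs.
subst m.
have {m0} q0 : (0 < q)%N by [].
have {mK} qK : (q < 4 * K)%N by [].
have [a ha] := nSd _ _ nin mnin.
set th := _ - _ in ha.
have th2 : `|th| <= 2 * e by [].
have qal : q%:R * al = a%:~R + th by rewrite /th -pmulrn; ring.
have qA : (q <= K ^ 10)%N.
  apply: leq_trans (ltnW qK) _; rewrite -{1}[K]expn1.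
  exact: leq_mul_expn2.
exists q; first by rewrite q0.
exists a; rewrite qal addrAC subrr add0r.
have [->|th0] := eqVneq th 0.
  by rewrite normr0 divr_ge0 // mulr_ge0 // exprn_ge0.
have t0 : 0 < `|th| by rewrite normr_gt0.
have q0R : 0 < q%:R :> R by rewrite ltr0n.
have N0R : 0 < N%:R :> R by rewrite ltr0n.
have k9e : 512 * K%:R * e <= 1.
  apply: le_trans eK; rewrite mulrC ler_wpM2l //.
  rewrite exprSr ler_wpM2r //.
  have -> : 512 = 2 ^+ 9 :> R by rewrite -natrX.
  by rewrite lerXn2r // nnegrE; lra.
have e4 : 2 * e < 1/2.
  have : 2 * e <= K%:R * e by rewrite ler_wpM2r.
  by lra.
have qKR : q%:R <= 4 * K%:R :> R by rewrite -natrM ler_nat ltnW.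
(* the longest window, of length at most N, on which th stays invisible *)
have [H [H0 HN Hth Hbig]] : exists H : nat, [/\ (16 * K ^ 2 <= H)%N, (H <= N)%N,
    2 * `|th| * H%:R <= q%:R & (H = N) \/ q%:R <= 4 * `|th| * H%:R].
  have [le|gt] := leP (2 * `|th| * N%:R) q%:R.
    by exists N; split=> //; left.
  pose z : R := q%:R / (2 * `|th|).
  have zth : 2 * `|th| * z = q%:R by rewrite /z mulrCA divff ?mulr1 ?mulf_neq0 // gt_eqF.
  have z0 : 0 <= z by rewrite divr_ge0 // mulr_ge0.
  exists (Num.truncn z); have := truncn_itv z0.
  have hz : 32 * K%:R ^+ 2 <= z.
    rewrite /z ler_pdivlMr ?mulr_gt0 //.
    have h1 : K%:R ^+ 2 * 256 <= K%:R ^+ 10 :> R.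
      rewrite (exprD _ 2 8) ler_wpM2l ?exprn_ge0 //.
      have -> : 256 = 2 ^+ 8 :> R by rewrite -natrX.
      by rewrite lerXn2r // nnegrE; lra.
    have h2 : `|th| * (K%:R ^+ 2 * 256) <= 2 * e * K%:R ^+ 10.
      by rewrite ler_pM // mulr_ge0 // exprn_ge0.
    have : 1 <= q%:R :> R by rewrite ler1n.
    by lra.
  have k2' : 4 <= K%:R ^+ 2 :> R by rewrite expr2; nra.
  move=> /andP [tz1 tz2]; split.
  - rewrite -(ler_nat R) natrM natrX; rewrite -natr1 in tz2; lra.
  - rewrite -(ler_nat R); apply: le_trans tz1 _.
    by rewrite /z ler_pdivrMr ?mulr_gt0 //; lra.
  - by rewrite -zth ler_wpM2l // mulr_ge0.
  - right; rewrite -natr1 in tz2.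
    have : z <= 2 * (Num.truncn z)%:R by lra.
    by rewrite -(ler_pM2l (_ : 0 < 2 * `|th|)) ?mulr_gt0 // zth; lra.
have qK4 : (4 * q * K <= H)%N.
  by apply: leq_trans H0; rewrite -mulnn; clear -qK; nia.
have qKgt0 : (0 < 4 * q * K)%N by rewrite !muln_gt0 q0.
have Hgt0 : (0 < H)%N by apply: leq_trans qK4.
have [t [t0' tH Ht]] : exists t, [/\ (0 < t)%N, (t * (4 * q * K) <= H)%N &
    (H < t.+1 * (4 * q * K))%N].
  exists (H %/ (4 * q * K))%N.
  by rewrite divn_gt0 // qK4 leq_trunc_div ltn_ceil.
have [n' [m []]] : exists n m : int, [/\ n \in S, n + m *+ (q * t) \in S,
    0 < m & m *+ (q * t) < H%:Z].
  apply: (@congruent_pair S N); rewrite ?muln_gt0 ?q0 //.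
  have := leq_trunc_div (2 * N) H; move: (_ %/ _)%N => u hu.
  have h1 : (u.+1 * H <= 3 * N)%N by rewrite mulSn; clear -hu HN; lia.
  have : (u.+1 * (q * t) * (4 * K) <= 3 * N)%N.
    by apply: leq_trans h1; rewrite -!mulnA leq_mul2l; apply/orP; right; clear -tH; lia.
  move: (u.+1 * _)%N => v hv.
  suff : (K * v < K * size S)%N by rewrite ltn_pmul2l.
  by apply: leq_trans dS; clear -hv N1; lia.
move=> n'in mnin' m0 mH.
have [j jm] : exists j : nat, m = j%:Z by exists `|m|%N; rewrite gtz0_abs.
subst m.
have {m0} j0 : (0 < j)%N by [].
have {mH} jH : (j * (q * t) < H)%N by move: mH; rewrite -mulr_natr natz.
have [z hz] := nSd _ _ n'in mnin'.
pose w : int := z - (j * t)%N%:Z * a.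
have hw : `|(j * t)%:R * th - w%:~R| <= 2 * e.
  apply: le_trans hz; rewrite le_eqVlt; apply/orP; left; apply/eqP; congr `|_|.
  have -> : (j%:Z *+ (q * t))%:~R = (j * t)%:R * q%:R :> R.
    by rewrite rmorphMn /= -pmulrn -mulr_natr -!natrM [(q * t)%N]mulnC mulnA.
  rewrite -mulrA qal /w intrD intrN intrM -!pmulrn. ring.
have jth : `|(j * t)%:R * th| <= 1 / 2.
  rewrite normrM normr_nat.
  have : (j * t)%:R * q%:R <= H%:R :> R.
    by rewrite -natrM ler_nat; apply: leq_trans (ltnW jH); rewrite -mulnA [(t * q)%N]mulnC.
  move=> h; rewrite -(ler_pM2r q0R).
  have : (j * t)%:R * q%:R * `|th| <= H%:R * `|th| by rewrite ler_wpM2r.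
  lra.
have w0 : w = 0.
  have : `|w%:~R| < 1 :> R.
    rewrite -[w%:~R](subKr ((j * t)%:R * th)).
    by apply: le_lt_trans (ler_normB _ _) _; lra.
  by rewrite -intr_norm ltrz1; move: (w); clear; lia.
have tth : t%:R * `|th| <= 2 * e.
  move: hw; rewrite w0 subr0 normrM normr_nat natrM; apply: le_trans.
  by rewrite -mulrA ler_peMl ?mulr_ge0 // ler1n.
have hH : H%:R * `|th| <= 16 * q%:R * K%:R * e.
  have : H%:R <= 2 * t%:R * (4 * q%:R * K%:R) :> R.
    rewrite -!natrM ler_nat; apply: ltnW (leq_trans Ht _).
    by rewrite leq_mul2r; apply/orP; right; move: t0'; clear; lia.
  move=> /(ler_wpM2r (ltW t0)) h; apply: le_trans h _.
  have := ler_wpM2l (_ : 0 <= 8 * q%:R * K%:R) tth; rewrite !mulr_ge0 // => /(_ isT).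
  lra.
case: Hbig => [HE|le4]; last first.
  exfalso; have h : q%:R <= q%:R * (64 * (K%:R * e)) by lra.
  by move: h; rewrite ler_pMr //; lra.
rewrite ler_pdivlMr // mulrC -HE; apply: le_trans hH _.
rewrite ler_wpM2r //.
have h1 : 64 * K%:R ^+ 2 <= K%:R ^+ 10 :> R.
  by rewrite -!natrX -natrM ler_nat; apply: leq_mul_expn2.
apply: le_trans h1; rewrite expr2.
by have := ler_wpM2r (_ : 0 <= K%:R) qKR; rewrite ler0n => /(_ isT); lra.
Qed.

End Linear.

(** The pairs of points of [S] are distributed among the differences [h]; since
    there are few differences, many of them occur for many pairs. *)
Lemma popular_differences (K N : nat) (S : seq int) :
  (0 < K)%N -> (0 < N)%N -> uniq S -> {in S, forall n, `|n| <= N%:Z} ->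
  (N <= K * size S)%N ->
  exists H : seq int, [/\ uniq H, {in H, forall h : int, `|h| <= (2 * N)%N%:Z},
    (2 * N <= 16 * K ^ 2 * size H)%N &
    {in H, forall h : int, (N <= 16 * K ^ 2 * size [seq n <- S | (n + h)%R \in S])%N}].
Proof.
move=> K0 N0 uS bS dS.
pose rng := [seq i%:Z - (2 * N)%N%:Z | i <- iota 0 (4 * N).+1].
have rngE h : (h \in rng) = (`|h| <= (2 * N)%N%:Z).
  apply/mapP/idP => [[i + ->]|hb]; rewrite ?mem_iota; first by clear; lia.
  by exists (absz (h + (2 * N)%N%:Z)); rewrite ?mem_iota; clear -hb; lia.
have urng : uniq rng.
  rewrite map_inj_uniq ?iota_uniq // => i j /addIr [] //.
pose w (h : int) : rat := (size [seq n <- S | n + h \in S])%:R.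
pose c : rat := N%:R / (10 * K%:R ^+ 2).
have K0q : 0 < K%:R :> rat by rewrite ltr0n.
have N0q : 0 < N%:R :> rat by rewrite ltr0n.
have c0 : 0 <= c by rewrite divr_ge0 ?mulr_ge0 ?exprn_ge0 ?ler0n.
have cK : 10 * K%:R ^+ 2 * c = N%:R.
  by rewrite /c mulrC divfK // mulf_neq0 // expf_neq0 // gt_eqF.
have sS : (size S <= 3 * N)%N.
  pose rng' := [seq i%:Z - N%:Z | i <- iota 0 (2 * N).+1].
  have : (size S <= size rng')%N.
    apply: uniq_leq_size => // n /bS bn; apply/mapP.
    by exists (absz (n + N%:Z)); rewrite ?mem_iota; move: bn; clear; lia.
  by rewrite size_map size_iota; clear -N0; lia.
have wX h : w h <= (3 * N)%:R.
  by rewrite ler_nat; apply: leq_trans sS; rewrite size_filter count_size.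
have wsum : (size S)%:R ^+ 2 <= \sum_(h <- rng) w h.
  rewrite /w -natr_sum -natrX ler_nat.
  under eq_bigr => h _ do rewrite size_filter -sum1_count big_mkcond /=.
  have -> : (size S ^ 2 = \sum_(n <- S) size S)%N.
    by rewrite big_const_seq count_predT iter_addn_0 mulnn.
  rewrite exchange_big /= !big_seq leq_sum // => n nS.
  rewrite -big_mkcond sum1_count -size_filter -(size_map (fun x => x - n)).
  apply: uniq_leq_size; first by rewrite map_inj_uniq // => x y /addIr.
  move=> _ /mapP [x xS ->]; rewrite mem_filter rngE addrC subrK xS /=.
  by move: (bS _ xS) (bS _ nS); clear; lia.
have szr : (size rng)%:R = 4 * N%:R + 1 :> rat.
  by rewrite size_map size_iota -natr1 natrM.
have N1q : 1 <= N%:R :> rat by rewrite ler1n.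
have SN : N%:R ^+ 2 <= K%:R ^+ 2 * (size S)%:R ^+ 2 :> rat.
  by rewrite -exprMn lerXn2r ?nnegrE ?mulr_ge0 ?ler0n // -natrM ler_nat.
have key : 2 * c * (size rng)%:R <= \sum_(h <- rng) w h.
  apply: le_trans wsum.
  rewrite szr -(ler_pM2l (_ : 0 < K%:R ^+ 2)) ?exprn_gt0 //.
  apply: le_trans SN; rewrite expr2 -[X in _ <= X * _]cK; nra.
have := popular_values c0 wX key; set H := [seq h <- rng | c <= w h] => hH.
have E16 (s : nat) : (16 * K ^ 2 * s)%:R = 16 * K%:R ^+ 2 * s%:R :> rat.
  by rewrite natrM natrM natrX.
have toN (s : nat) : c <= s%:R -> (N <= 16 * K ^ 2 * s)%N.
  move=> cs; rewrite -(ler_nat rat) E16 -cK.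
  have := ler_wpM2l (exprn_ge0 2 (ltW K0q)) cs.
  by have := mulr_ge0 (exprn_ge0 2 (ltW K0q)) (ler0n rat s); lra.
exists H; split.
- exact: filter_uniq.
- by move=> h; rewrite mem_filter rngE => /andP [].
- rewrite -(ler_nat rat) E16 natrM -(ler_pM2r N0q).
  move: hH; rewrite szr natrM => hH.
  have := ler_wpM2l (exprn_ge0 2 (ltW K0q)) hH.
  have -> : 2 * N%:R * N%:R = 20 * K%:R ^+ 2 * c * N%:R :> rat.
    by rewrite -[X in _ * X * _ = _]cK; ring.
  have := mulr_ge0 (mulr_ge0 (exprn_ge0 2 (ltW K0q)) (ltW N0q)) (ler0n rat (size H)).
  have := mulr_ge0 (exprn_ge0 2 (ltW K0q)) c0.
  lra.
- by move=> h; rewrite mem_filter => /andP [/toN].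
Qed.

(** * Recurrence of polynomials *)
Section PolyRecurrence.
Context {R : realType}.

Definition pshift (p : {poly R}) (h : R) := p \Po ('X + h%:P) - p.

Lemma pshiftE (p : {poly R}) h x : (pshift p h).[x] = p.[x + h] - p.[x].
Proof. by rewrite /pshift hornerE horner_comp !hornerE. Qed.

(** The reason for looking at the linear coefficient only: as a function of
    the shift [h] it is the polynomial [p^`() - p`_1], whose coefficients are
    those of [p] of index at least 2, up to bounded integer factors. *)
Lemma pshift_coef1 (p : {poly R}) h : (pshift p h)`_1 = p^`().[h] - p`_1.
Proof.
have E (q : {poly R}) : q`_1 = q^`().[0] by rewrite horner_coef0 coef_deriv mulr1n.
rewrite E derivB hornerD hornerN -(E p) deriv_comp derivD derivX derivC addr0 mulr1.
by rewrite horner_comp hornerD hornerX hornerC add0r.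
Qed.

Lemma size_pshift (p : {poly R}) h d : (size p <= d.+2)%N -> (size (pshift p h) <= d.+1)%N.
Proof.
move=> sp; have sX : size ('X + h%:P) = 2%N by rewrite size_XaddC.
have [->|p0] := eqVneq p 0; first by rewrite /pshift comp_poly0 subrr size_poly0.
have mX : 'X + h%:P \is monic by rewrite -[h]opprK polyCN monicXsubC.
have sc : size (p \Po ('X + h%:P)) = size p by rewrite size_comp_poly2.
apply/leq_sizeP => j dj; rewrite coefB.
have [lt|ge] := ltnP j (size p).-1.
  by move: lt sp dj; clear; lia.
have [eqj|gtj] := eqVneq j (size p).-1; last first.
  have jp : (size p <= j)%N by move: ge gtj; clear; lia.
  by rewrite !nth_default ?sc // subrr.
have -> : p`_j = lead_coef p by rewrite eqj.
have -> : (p \Po ('X + h%:P))`_j = lead_coef (p \Po ('X + h%:P)).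
  by rewrite /lead_coef sc eqj.
by rewrite lead_coef_comp ?sX // (monicP mX) expr1n mulr1 subrr.
Qed.

(** If the coefficients of index at least [m] are close to multiples of [1 / Q]
    at scale [N], the corresponding terms are negligible at a point [n] of
    [[-N, N]] after multiplication by [Q]. *)
Lemma nearint_low (p : {poly R}) (D m Q N : nat) (c : R) (n : int) :
  (size p <= D.+1)%N -> (m <= D.+1)%N -> (0 < N)%N -> `|n| <= N%:Z -> 0 <= c ->
  (forall j, (m <= j)%N -> nearint (Q%:R * p`_j) (c / N%:R ^+ j)) ->
  nearint (Q%:R * p.[n%:~R]) c ->
  nearint (\sum_(i < m) Q%:R * p`_i * n%:~R ^+ i) (D.+2%:R * c).
Proof.
move=> sp mD N0 nN c0 hj hp.
have Nn0 : (N%:R : R) != 0 by rewrite pnatr_eq0 -lt0n.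
rewrite (big_ord_widen _ (fun i => Q%:R * p`_i * n%:~R ^+ i) mD).
have E : Q%:R * p.[n%:~R] = \sum_(i < D.+1) Q%:R * p`_i * n%:~R ^+ i.
  by rewrite (horner_coef_wide _ sp) big_distrr; apply: eq_bigr => i _; rewrite /= mulrA.
move: hp; rewrite E (bigID (fun i : 'I_D.+1 => i < m)%N) /=.
set X := (X in nearint (X + _)); set Y := (Y in nearint (_ + Y)) => hp.
rewrite -/X.
have hY : nearint Y (D.+1%:R * c).
  have : nearint Y (\sum_(i < D.+1 | ~~ (i < m)%N) c).
    apply: nearint_sum => i; rewrite -leqNgt => mi.
    have := nearintZ (n ^+ i) (hj _ mi); rewrite rmorphXn /= mulrC.
    apply: nearint_le; rewrite normrX mulrCA ler_piMr // ler_pdivrMr ?mul1r.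
      rewrite lerXn2r ?nnegrE // -intr_norm -[N%:R]/((N%:Z)%:~R).
      by rewrite ler_int.
    by rewrite exprn_gt0 // ltr0n.
  apply: nearint_le; rewrite sumr_const mulr_natl.
  by rewrite ler_wpMn2l // (leq_trans (max_card _)) // card_ord.
have := nearintB hp hY; rewrite addrK; apply: nearint_le.
by rewrite -!natr1; lra.
Qed.

(** The factor [l] which differentiation puts in front of [p`_l] is removed by
    multiplying by [(d.+1)`!], a multiple of all these factors. *)
Lemma nearint_coef_of_deriv (p : {poly R}) (d q q2 N : nat) (c : R) :
  (size p <= d.+2)%N -> 0 <= c ->
  (forall j, nearint (q2%:R * (q%:R *: (p^`() - (p`_1)%:P))`_j) (c / N%:R ^+ j)) ->
  forall l, (2 <= l)%N ->
    nearint ((q2 * q * (d.+1)`!)%:R * p`_l) ((d.+1)`!%:R * (c / N%:R ^+ l.-1)).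
Proof.
move=> sp c0 hr [//|j] j1 /=; set F := (d.+1)`!.
have cj0 : 0 <= c / N%:R ^+ j by rewrite divr_ge0 ?exprn_ge0.
have [jd|dj] := leqP j.+1 d.+1; last first.
  rewrite (leq_sizeP _ _ sp j.+1) // mulr0; exists 0.
  by rewrite subr0 normr0 mulr_ge0.
have Fj : (F %/ j.+1 * j.+1)%N = F.
  by rewrite divnK // dvdn_fact // jd.
have := nearintM (F %/ j.+1) (hr j).
have -> : (q%:R *: (p^`() - (p`_1)%:P))`_j = q%:R * (j.+1%:R * p`_j.+1).
  rewrite coefZ coefB coef_deriv coefC [j.+1%:R * _]mulr_natl.
  by case: (j) j1 => // i _; rewrite subr0.
have -> : (F %/ j.+1)%:R * (q2%:R * (q%:R * (j.+1%:R * p`_j.+1))) =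
    (q2 * q * F)%:R * p`_j.+1.
  by rewrite -{2}Fj !natrM; ring.
by apply: nearint_le; rewrite ler_wpM2r // ler_nat leq_div.
Qed.

(** Induction on the degree, by differencing. For many [h], the polynomial
    [pshift p h], of smaller degree, is near integers at many points, so by
    induction its linear coefficient [p^`().[h] - p`_1] is close to a rational
    with small denominator; the denominator can be taken to be the same for
    many [h].  By induction once more, applied now to a polynomial in [h], all
    coefficients of [p] of index at least 2 are controlled.  Subtracting the
    corresponding terms leaves a linear function, for which
    [recurrence_linear] applies; the constant coefficient then follows from the
    value of [p] at a single point. *)
Lemma recurrence_poly d : exists A : nat, forall (K N : nat) (e : R)
    (p : {poly R}) (S : seq int),
  (1 < K)%N -> (K ^ A <= N)%N -> e * K%:R ^+ A <= 1 -> (size p <= d.+1)%N ->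
  uniq S -> {in S, forall n, `|n| <= N%:Z} -> (N <= K * size S)%N ->
  {in S, forall n, nearint p.[n%:~R] e} ->
  exists2 q, (0 < q <= K ^ A)%N &
    forall j, nearint (q%:R * p`_j) (K%:R ^+ A * e / N%:R ^+ j).
Proof.
elim: d => [|d [A IH]].
  exists 0%N => K N e p S K1 KN eK sp uS bS dS nS; exists 1%N => // j.
  rewrite expr0 !mul1r.
  have [n nSn] : exists n, n \in S.
    by case: S dS {uS bS nS} KN => [|n S]; [rewrite muln0; lia|exists n; rewrite mem_head].
  have := nS _ nSn; rewrite (size1_polyC sp) hornerC => h.
  rewrite coefC; case: j => [|j] /=; first by rewrite expr0 divr1.
  exists 0; rewrite subr0 normr0 divr_ge0 ?exprn_ge0 ?ler0n //.
  exact: nearint_ge0 h.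
pose F := (d.+1)`!.
pose a := ((6 * A + 6) * A + 6 * A)%N.
pose B := (a + 2 * F)%N.
pose A' := (B + 2 * d + 20)%N.
exists A' => K N e p S K1 KN eK sp uS bS dS nS.
have K0 : (0 < K)%N := ltnW K1.
have powN b : (b <= A')%N -> (K ^ b <= N)%N.
  by move=> aA; apply: leq_trans KN; rewrite leq_exp2l.
have N0 : (0 < N)%N by apply: (powN 0%N).
have [n0 n0S] : exists n, n \in S.
  by case: S dS {uS bS nS} => [|n S]; [rewrite muln0 leqNgt N0|exists n; rewrite mem_head].
have e0 : 0 <= e := nearint_ge0 (nS _ n0S).
have powe c b : (c + b <= A')%N -> c%:R * (K%:R ^+ b * e) <= 1.
  by move=> ca; apply: le_trans (ler_mul_expn K1 ca e0) _; rewrite mulrC.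
have k1 : 1 <= K%:R :> R by rewrite ler1n.
have N0R : 0 < N%:R :> R by rewrite ltr0n.
have N1R : 1 <= N%:R :> R by rewrite ler1n.
have [H [uH bH dH SH]] := popular_differences K0 N0 uS bS dS.
have c16 : (16 * K ^ 2 <= K ^ 6)%N by apply: leq_mul_expn2.
have stepH h : h \in H -> exists2 q, (0 < q <= K ^ (6 * A))%N &
    nearint (q%:R * (p^`().[h%:~R] - p`_1)) (K%:R ^+ (6 * A) * (2 * e) / N%:R).
  move=> hH.
  have [] := IH (K ^ 6)%N N (2 * e) (pshift p h%:~R) [seq n <- S | n + h \in S].
  - by rewrite -(exp1n 6) ltn_exp2r.
  - by rewrite -expnM powN // /A' /B /a; clear; lia.
  - rewrite natrX -exprM -mulrA [e * _]mulrC.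
    by apply: (powe 2%N); rewrite /A' /B /a; clear; lia.
  - exact: size_pshift.
  - exact: filter_uniq.
  - by move=> n; rewrite mem_filter => /andP [_ /bS].
  - by apply: leq_trans (SH _ hH) _; rewrite leq_mul2r c16 orbT.
  - move=> n; rewrite mem_filter => /andP [nh nSn]; rewrite pshiftE -intrD.
    by have := nearintB (nS _ nh) (nS _ nSn); apply: nearint_le; lra.
  move=> q; rewrite -expnM => qA /(_ 1%N); rewrite pshift_coef1 natrX -exprM.
  by exists q.
have K6 : (0 < K ^ (6 * A))%N by rewrite expn_gt0 K0.
have [q qA] := common_witness K6 stepH.
set H' := seq.filter _ H => dH'.
pose r : {poly R} := q%:R *: (p^`() - (p`_1)%:P).
have [] := IH (K ^ (6 * A + 6))%N (2 * N)%N (K%:R ^+ (6 * A) * (2 * e) / N%:R) r H'.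
- by apply: (leq_trans K1); rewrite -{1}[K]expn1 leq_exp2l // addn_gt0 orbT.
- rewrite -expnM; apply: (@leq_trans N); last by rewrite leq_pmull.
  by apply: powN; rewrite /A' /B /a; clear; lia.
- rewrite natrX -exprM mulrAC ler_pdivrMr // mul1r; apply: le_trans N1R.
  have -> : K%:R ^+ (6 * A) * (2 * e) * K%:R ^+ ((6 * A + 6) * A) =
      2%:R * (K%:R ^+ ((6 * A + 6) * A + 6 * A) * e) :> R.
    by rewrite exprD; ring.
  by apply: powe; rewrite /A' /B /a; clear; lia.
- apply/leq_sizeP => j dj; rewrite coefZ coefB coef_deriv coefC.
  rewrite (leq_sizeP _ _ sp j.+1) // mul0rn.
  by case: j dj => // j _; rewrite subrr mulr0.
- exact: filter_uniq.
- by move=> h; rewrite mem_filter => /andP [_ /bH].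
- apply: leq_trans dH (leq_trans (leq_mul c16 dH') _).
  by rewrite mulnA -expnD [(6 + _)%N]addnC.
- move=> h; rewrite mem_filter => /andP [/asboolP hh _].
  by rewrite /r hornerZ hornerD hornerN hornerC.
move=> q2; rewrite -expnM => q2A hr.
pose Q := (q2 * q * F)%N.
pose c1 := K%:R ^+ B * e.
have hQ l : (2 <= l)%N -> nearint (Q%:R * p`_l) (c1 / N%:R ^+ l).
  set E := (K ^ (6 * A + 6))%:R ^+ A * _ in hr.
  have EE : E = 2%:R * (K%:R ^+ a * e) / N%:R.
    by rewrite /E natrX -exprM /a exprD; ring.
  have E0 : 0 <= E by rewrite EE divr_ge0 ?mulr_ge0 ?exprn_ge0.
  move=> l2; have := nearint_coef_of_deriv sp E0 hr l2.
  case: l l2 => [//|j] _; apply: nearint_le => /=.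
  apply: (@le_trans _ _ (F%:R * (E / N%:R ^+ j))).
    rewrite ler_wpM2l // ler_wpM2l // lef_pV2 ?posrE ?exprn_gt0 ?ltr0n ?muln_gt0 ?N0 //.
    by rewrite lerXn2r ?nnegrE ?ler0n // ler_nat mul2n -addnn leq_addr.
  rewrite EE exprS invfM !mulrA ler_wpM2r ?invr_ge0 ?exprn_ge0 //.
  rewrite ler_wpM2r ?invr_ge0 // -mulrA -natrM.
  by apply: ler_mul_expn => //; rewrite /B /a; clear; lia.
have c10 : 0 <= c1 by rewrite mulr_ge0 ?exprn_ge0.
have qF : (Q <= K ^ B)%N.
  have aF : (F * K ^ a <= K ^ B)%N by apply: leq_mul_expn => //; rewrite /B; clear; lia.
  apply: leq_trans aF; rewrite /Q mulnC leq_mul2l /a expnD; apply/orP; right.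
  by move: q2A qA => /andP [_ h2] /andP [_ h1]; apply: leq_mul.
have Qe : Q%:R * e <= c1.
  by rewrite ler_wpM2r // -natrX ler_nat.
have nearQ n : n \in S -> nearint (Q%:R * p.[n%:~R]) c1.
  by move=> /nS /(nearintM Q); apply: nearint_le.
(* Subtracting the terms of degree at least 2 leaves a linear function. *)
have [] := @recurrence_linear _ K N (d.+3%:R * c1) (Q%:R * p`_1) (Q%:R * p`_0) S.
- by [].
- by rewrite powN // /A'; clear; lia.
- rewrite -mulrA (mulrC c1) /c1 [K%:R ^+ 10 * _]mulrA -exprD.
  by apply: powe; rewrite /A'; clear; lia.
- by [].
- by [].
- by [].
- move=> n nSn.
  have := nearint_low (m := 2) sp _ N0 (bS _ nSn) c10 hQ (nearQ _ nSn).
  by rewrite !big_ord_recl big_ord0 /= expr0 expr1 mulr1 addr0 addrC; apply.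
move=> q4 q4A h1.
pose c3 := d.+3%:R * (K%:R ^+ 10 * c1).
have c30 : 0 <= c3 by rewrite !mulr_ge0 ?exprn_ge0.
have q4c : q4%:R * c1 <= c3.
  have h : q4%:R * c1 <= K%:R ^+ 10 * c1.
    by rewrite ler_wpM2r // -natrX ler_nat; case/andP: q4A.
  by apply: le_trans h _; rewrite /c3 ler_peMl ?mulr_ge0 ?exprn_ge0 // ler1n.
have hj j : (1 <= j)%N -> nearint ((q4 * Q)%:R * p`_j) (c3 / N%:R ^+ j).
  rewrite natrM -mulrA; case: j => [//|[|j]] _.
    by rewrite expr1; apply: nearint_le h1; rewrite /c3; lra.
  have := nearintM q4 (hQ j.+2 isT); apply: nearint_le.
  rewrite mulrA ler_wpM2r ?invr_ge0 ?exprn_ge0 //; exact: q4c.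
have c3le : c3 <= K%:R ^+ (B + d + 13) * e.
  by rewrite /c3 /c1 [K%:R ^+ 10 * _]mulrA -exprD; apply: ler_mul_expn => //; clear; lia.
have c3A : d.+3%:R * c3 <= K%:R ^+ A' * e.
  apply: le_trans (ler_wpM2l (ler0n _ _) c3le) _.
  by apply: ler_mul_expn => //; rewrite /A'; clear; lia.
exists (q4 * Q)%N.
  rewrite !muln_gt0 fact_gt0.
  move: q4A qA q2A => /andP [-> q4l] /andP [-> _] /andP [-> _] /=.
  apply: leq_trans (leq_mul q4l qF) _; rewrite -expnD leq_exp2l //.
  by rewrite /A'; clear; lia.
case=> [|j].
  rewrite expr0 divr1; apply: nearint_le c3A _.
  have hp : nearint ((q4 * Q)%:R * p.[n0%:~R]) c3.
    by rewrite natrM -mulrA; apply: nearint_le (nearintM q4 (nearQ _ n0S)).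
  have := nearint_low (m := 1) sp _ N0 (bS _ n0S) c30 hj hp.
  by rewrite big_ord_recl big_ord0 expr0 mulr1 addr0; apply.
apply: nearint_le (hj j.+1 isT); rewrite ler_wpM2r ?invr_ge0 ?exprn_ge0 //.
by apply: le_trans c3A; rewrite ler_peMl // ler1n.
Qed.

End PolyRecurrence.

(** * The additive character *)
Section Normc.
Context {R : realType}.
Implicit Types z w : R[i].

Lemma sqr_normcE (a b : R) : normc (a +i* b)%C ^+ 2 = a ^+ 2 + b ^+ 2.
Proof. by rewrite /= sqr_sqrtr // addr_ge0 // sqr_ge0. Qed.

Lemma normc_ge0 z : 0 <= normc z.
Proof. by case: z => a b; apply: sqrtr_ge0. Qed.

Lemma normc_tri z w : normc (z + w) <= normc z + normc w.
Proof. exact: (@le_normcD R z w). Qed.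

Lemma normc_opp z : normc (- z) = normc z.
Proof. exact: (@normcN R z). Qed.

Lemma normc_sum (I : Type) (r : seq I) (P : pred I) (F : I -> R[i]) :
  normc (\sum_(i <- r | P i) F i) <= \sum_(i <- r | P i) normc (F i).
Proof.
elim/big_rec2: _ => [|i x y _ IH]; first by rewrite normc0.
by apply: le_trans (normc_tri _ _) _; rewrite lerD2l.
Qed.

Lemma normc_triB z w : normc z - normc w <= normc (z - w).
Proof.
by rewrite lerBlDr -{1}[z](subrK w); apply: normc_tri.
Qed.

Lemma expiD (x y : R) : expi (x + y) = expi x * expi y.
Proof.
rewrite /expi mulrDr cosD sinD; apply/eqP; rewrite eq_complex /=.
by apply/andP; split; apply/eqP; ring.
Qed.

Lemma expi0 : expi (0 : R) = 1.
Proof. by rewrite /expi mulr0 cos0 sin0. Qed.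

Lemma normc_expi (x : R) : normc (expi x) = 1.
Proof.
apply/eqP; rewrite -(@eqrXn2 _ 2) ?normc_ge0 //.
by rewrite sqr_normcE expr1n cos2Dsin2.
Qed.

Lemma expi1 : expi (1 : R) = 1.
Proof. by rewrite /expi mulr1 mulr_natl cos2pi sin2pi. Qed.

Lemma expi_int (m : int) : expi (m%:~R : R) = 1.
Proof.
have expi_nat (n : nat) : expi (n%:R : R) = 1.
  by elim: n => [|n IH]; rewrite ?expi0 // -natr1 expiD IH expi1 mulr1.
case: m => n; first exact: expi_nat.
have := expiD (- n.+1%:R) n.+1%:R.
by rewrite addNr expi0 expi_nat mulr1 NegzE intrN => <-.
Qed.

Lemma expiDint (x : R) (m : int) : expi (x + m%:~R) = expi x.
Proof. by rewrite expiD expi_int mulr1. Qed.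

Lemma sqr_normc_expiB1 (x : R) : normc (expi x - 1) ^+ 2 = 2 - 2 * cos (2 * pi * x).
Proof.
rewrite /expi [X in normc X](_ : _ = ((cos (2 * pi * x) - 1) +i* sin (2 * pi * x))%C).
  by rewrite sqr_normcE; have := cos2Dsin2 (2 * pi * x); lra.
by apply/eqP; rewrite eq_complex /= subr0 !eqxx.
Qed.

Lemma sin_le (t : R) : `|sin t| <= `|t|.
Proof.
wlog t0 : t / 0 < t.
  move=> W; have [t0|t0|->] := ltrgt0P t.
  - by have := W _ t0; rewrite (gtr0_norm t0).
  - have := W (- t); rewrite oppr_gt0 sinN normrN => /(_ t0).
    by rewrite normrN (ltr0_norm t0).
  - by rewrite sin0 normr0.
have [|c _] := @MVT R sin cos 0 t t0.
  by apply: continuous_subspaceT => x; apply: continuous_sin.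
rewrite sin0 !subr0 => ->; rewrite normrM ler_piMl //.
exact: cos_max.
Qed.

Lemma normc_expiB1_le (x : R) : normc (expi x - 1) <= 8 * `|x|.
Proof.
rewrite -(@ler_pXn2r _ 2) ?nnegrE ?normc_ge0 ?mulr_ge0 // sqr_normc_expiB1.
have -> : 2 * pi * x = (pi * x) *+ 2 by rewrite [RHS]mulr2n; ring.
rewrite cos_mulr2n [_ *+ 2]mulr2n.
have s := cos2Dsin2 (pi * x).
have h : sin (pi * x) ^+ 2 <= (4 * `|x|) ^+ 2.
  rewrite -(real_normK (num_real (sin _))) lerXn2r ?nnegrE ?mulr_ge0 //.
  apply: le_trans (sin_le _) _; rewrite normrM ler_wpM2r //.
  by rewrite ger0_norm ?pi_ge0 //; have := pihalf_lt2 R; lra.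
by move: h; rewrite !exprMn; lra.
Qed.

Lemma normc_expiB (x y : R) : normc (expi x - expi y) <= 8 * `|x - y|.
Proof.
have -> : expi x - expi y = expi y * (expi (x - y) - 1).
  by rewrite mulrBr mulr1 -expiD (addrC y) subrK.
by rewrite normcM normc_expi mul1r normc_expiB1_le.
Qed.

(** For [1 / 4 <= `|x| <= 1 / 2] the point [expi x] lies in the left half-plane,
    at distance at least 1 from 1. Smaller [x] are doubled until they reach this
    range: [expi (2 * x) - 1 = (expi x - 1) * (expi x + 1)], so the distance
    at most doubles at each step. *)
Lemma normc_expiB1_ge (x : R) : `|x| <= 1 / 2 -> `|x| <= normc (expi x - 1).
Proof.
have [->|x0] := eqVneq x 0; first by rewrite normr0 normc_ge0.
move=> x2.
have [n] : exists n : nat, 1 <= 4 * 2 ^+ n * `|x|.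
  exists (Num.bound (1 / `|x|)).
  have := archi_boundP (_ : 0 <= 1 / `|x|); rewrite divr_ge0 // => /(_ isT).
  rewrite ltr_pdivrMr ?normr_gt0 // => h.
  have : (Num.bound (1 / `|x|))%:R <= 2 ^+ Num.bound (1 / `|x|) :> R.
    by rewrite -natrX ler_nat ltnW // ltn_expl.
  move=> /(ler_wpM2r (normr_ge0 x)); lra.
have large (y : R) : `|y| <= 1 / 2 -> 1 / 4 <= `|y| -> `|y| <= normc (expi y - 1).
  move=> y2 y4.
  have h : cos (2 * pi * y) <= 0.
    have -> : cos (2 * pi * y) = cos (2 * pi * `|y|).
      by case: (ger0P y) => // _; rewrite mulrN cosN.
    have -> : 2 * pi * `|y| = 2 * pi * (`|y| - 1 / 4) + pi / 2 by lra.
    rewrite cosDpihalf oppr_le0 sin_ge0_pi //; apply/andP.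
    by have p0 := pi_ge0 R; split; nra.
  apply: (@le_trans _ _ 1); first lra.
  by rewrite -(@ler_pXn2r _ 2) ?nnegrE ?normc_ge0 // sqr_normc_expiB1; lra.
elim: n x {x0} x2 => [|n IH] x x2 hn.
  by apply: large => //; move: hn; rewrite expr0; lra.
have [x4|x4] := leP (1 / 4) `|x|; first exact: large.
have := IH (2 * x); rewrite normrM ger0_norm // => h0.
have {h0} h : 2 * `|x| <= normc (expi (2 * x) - 1).
  apply: h0; first lra.
  by move: hn; rewrite exprS; lra.
have : normc (expi (2 * x) - 1) <= 2 * normc (expi x - 1).
  have -> : expi (2 * x) - 1 = (expi x - 1) * (expi x + 1).
    by rewrite mulr_natl mulr2n expiD; ring.
  rewrite normcM mulrC ler_wpM2r ?normc_ge0 //.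
  by apply: le_trans (normc_tri _ _) _; rewrite normc_expi normc1; lra.
by move: h; lra.
Qed.

Lemma nearint_expiB1 (x d : R) : normc (expi x - 1) <= d -> nearint x d.
Proof.
move=> h; pose m := Num.floor (x + 1 / 2); exists m.
have := floor_le (x + 1 / 2); have := floorD1_gt (x + 1 / 2); rewrite -/m intrD1 => h1 h2.
apply: le_trans h; rewrite -(expiDint x (- m)) intrN.
by apply: normc_expiB1_ge; rewrite ler_norml; lra.
Qed.

End Normc.

(** * Exponential sums over an interval *)
Section ExponentialSums.
Context {R : realType}.

Lemma normc_sum_expi_le (I : Type) (r : seq I) (f : I -> R) :
  normc (\sum_(i <- r) expi (f i)) <= (size r)%:R.
Proof.
apply: le_trans (normc_sum _ _ _) _.
rewrite (eq_bigr (fun=> 1)); last by move=> i _; rewrite normc_expi.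
by rewrite big_const_seq count_predT iter_addr_0.
Qed.

Lemma expiN_conj (x : R) : expi (- x) = conjc (expi x).
Proof. by rewrite /expi mulrN cosN sinN. Qed.

Lemma normc_conj (z : R[i]) : normc (conjc z) = normc z.
Proof. by case: z => a b /=; rewrite sqrrN. Qed.

Lemma sum_expiN (I : Type) (r : seq I) (f : I -> R) :
  \sum_(i <- r) expi (- f i) = conjc (\sum_(i <- r) expi (f i)).
Proof. by rewrite rmorph_sum; apply: eq_bigr => i _; rewrite expiN_conj. Qed.

(** The terms of the double sum are grouped according to [h.+1 = i - j] and
    [h.+1 = j - i]. *)
Lemma double_sum_diff (f : nat -> R) (L : nat) :
  \sum_(0 <= i < L) \sum_(0 <= j < L) expi (f i - f j) =
  L%:R + \sum_(0 <= h < L) (\sum_(0 <= j < L - h.+1) expi (f (j + h.+1)%N - f j)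
    + \sum_(0 <= j < L - h.+1) expi (- (f (j + h.+1)%N - f j))).
Proof.
elim: L => [|L IH]; first by rewrite !big_geq // addr0.
rewrite big_nat_recr //= (eq_bigr (fun i => \sum_(0 <= j < L) expi (f i - f j) +
   expi (f i - f L))); last by move=> i _; rewrite big_nat_recr.
rewrite big_split /= {}IH.
rewrite [\sum_(0 <= j < L.+1) expi (f L - f j)]big_nat_recr //= subrr expi0.
rewrite [X in _ = _ + X]big_nat_recr //=.
rewrite subnn [X in _ = _ + (_ + X)](_ : _ = 0) ?addr0; last by rewrite !big_geq // addr0.
have -> : \sum_(0 <= h < L) (\sum_(0 <= j < L.+1 - h.+1) expi (f (j + h.+1)%N - f j)
    + \sum_(0 <= j < L.+1 - h.+1) expi (- (f (j + h.+1)%N - f j))) =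
  \sum_(0 <= h < L) (\sum_(0 <= j < L - h.+1) expi (f (j + h.+1)%N - f j)
    + \sum_(0 <= j < L - h.+1) expi (- (f (j + h.+1)%N - f j))) +
  (\sum_(0 <= h < L) expi (f L - f (L - h.+1)%N) +
   \sum_(0 <= h < L) expi (f (L - h.+1)%N - f L)).
  rewrite -!big_split /= !big_nat; apply: eq_bigr => h /andP [_ hL].
  have -> : (L.+1 - h.+1 = (L - h.+1).+1)%N by lia.
  rewrite !big_nat_recr //= (_ : (L - h.+1 + h.+1)%N = L); last by rewrite subnK.
  by rewrite opprB addrACA.
have rv (g : nat -> R[i]) : \sum_(0 <= h < L) g (L - h.+1)%N = \sum_(0 <= h < L) g h.
  by rewrite [RHS]big_nat_rev /= add0n.
rewrite (rv (fun j => expi (f L - f j))) (rv (fun j => expi (f j - f L))).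
by rewrite -[L.+1%:R]natr1; ring.
Qed.

(** The sums over [h] run up to any [M >= L] because [L - h.+1] is 0 for [h >= L];
    this makes the number of shifts independent of the interval. *)
Lemma van_der_corput (f : nat -> R) (L M : nat) : (L <= M)%N ->
  normc (\sum_(0 <= j < L) expi (f j)) ^+ 2 <=
  L%:R + 2 * \sum_(0 <= h < M)
    normc (\sum_(0 <= j < L - h.+1) expi (f (j + h.+1)%N - f j)).
Proof.
move=> LM; set S := \sum_(0 <= j < L) _.
have -> : normc S ^+ 2 = normc (S * conjc S) by rewrite normcM normc_conj expr2.
have -> : S * conjc S = \sum_(0 <= i < L) \sum_(0 <= j < L) expi (f i - f j).
  rewrite /S -sum_expiN big_distrl /=; apply: eq_bigr => i _.
  by rewrite big_distrr /=; apply: eq_bigr => j _; rewrite -expiD.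
rewrite double_sum_diff; apply: le_trans (normc_tri _ _) _; apply: lerD.
  have := normc_sum_expi_le (nseq L tt) (fun=> 0).
  rewrite size_nseq big_const_seq count_nseq expi0 mul1n iter_addr_0; apply.
apply: le_trans (normc_sum _ _ _) _.
rewrite mulr_sumr [in leRHS](big_cat_nat (n := L)) //=.
apply: ler_wpDr.
  by apply: sumr_ge0 => h _; rewrite mulr_ge0 ?normc_ge0.
apply: ler_sum => h _; apply: le_trans (normc_tri _ _) _.
by rewrite sum_expiN normc_conj; lra.
Qed.

(** The sum telescopes after multiplication by [expi al - 1]. *)
Lemma geometric_sum (c al : R) (T : nat) :
  normc (expi al - 1) * normc (\sum_(0 <= i < T) expi (c + i%:R * al)) <= 2.
Proof.
rewrite -normcM.
have -> : (expi al - 1) * \sum_(0 <= i < T) expi (c + i%:R * al) =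
    expi (c + T%:R * al) - expi c.
  elim: T => [|T IH]; first by rewrite big_geq // mulr0 mul0r addr0 subrr.
  rewrite big_nat_recr //= mulrDr IH mulrBl mul1r -expiD.
  have -> : al + (c + T%:R * al) = c + T.+1%:R * al by rewrite -natr1; ring.
  by ring.
apply: le_trans (normc_tri _ _) _; rewrite normc_opp !normc_expi; lra.
Qed.

Lemma shift_sum (g : nat -> R[i]) (L s : nat) : (forall n, normc (g n) <= 1) ->
  normc (\sum_(0 <= j < L) g j - \sum_(0 <= j < L) g (j + s)%N) <= 2 * s%:R.
Proof.
move=> g1; elim: s => [|s IH].
  rewrite (eq_bigr (fun j => g (j + 0)%N)) ?subrr ?normc0 ?mulr0 // => j _.
  by rewrite addn0.
have E : \sum_(0 <= j < L) g (j + s.+1)%N = \sum_(0 <= j < L) g (j + s)%N + (g (L + s)%N - g s).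
  elim: (L) => [|l IHl]; first by rewrite !big_geq // add0r subrr.
  by rewrite !big_nat_recr //= IHl addSnnS; ring.
rewrite E opprD addrA; apply: le_trans (normc_tri _ _) _.
rewrite -[s.+1%:R]natr1 mulrDr mulr1 lerD // normc_opp.
apply: le_trans (normc_tri _ _) _; rewrite normc_opp.
by have := g1 (L + s)%N; have := g1 s; lra.
Qed.

(** Shifting the interval by [Q * i] changes the sum by at most [2 * Q * i];
    averaging over [i < T] replaces a sum over an interval by an average of
    sums over progressions of step [Q] and length [T]. *)
Lemma shift_average (g : nat -> R[i]) (L T Q : nat) : (forall n, normc (g n) <= 1) ->
  T%:R * normc (\sum_(0 <= j < L) g j) <=
  \sum_(0 <= j < L) normc (\sum_(0 <= i < T) g (j + Q * i)%N) + T%:R * (2 * (Q * T)%:R).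
Proof.
move=> g1; set S := \sum_(0 <= j < L) g j.
have E : T%:R * normc S = normc (\sum_(0 <= i < T) S).
  by rewrite big_const_nat subn0 iter_addr_0 (@normcMn R) mulr_natl.
rewrite E.
have -> : \sum_(0 <= i < T) S = \sum_(0 <= j < L) \sum_(0 <= i < T) g (j + Q * i)%N +
    \sum_(0 <= i < T) (S - \sum_(0 <= j < L) g (j + Q * i)%N).
  rewrite [X in _ = X + _]exchange_big -big_split /=.
  by apply: eq_bigr => i _; rewrite addrCA subrr addr0.
apply: le_trans (normc_tri _ _) _; apply: lerD; first exact: normc_sum.
apply: le_trans (normc_sum _ _ _) _.
apply: (@le_trans _ _ (\sum_(0 <= i < T) 2 * (Q * T)%:R)); last first.
  by rewrite big_const_nat subn0 iter_addr_0 -[leLHS]mulr_natl.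
rewrite !big_nat; apply: ler_sum => i /andP [_ iT].
apply: le_trans (shift_sum _ _ g1) _.
by rewrite ler_wpM2l // ler_nat leq_mul2l ltnW ?orbT.
Qed.

Lemma nearint_expi (x y e : R) :
  nearint (x - y) e -> normc (expi x - expi y) <= 8 * e.
Proof.
move=> [m hm]; rewrite -(expiDint y m); apply: le_trans (normc_expiB _ _) _.
by rewrite opprD addrA ler_wpM2l.
Qed.

(** When the coefficients of index at least 2 are close to multiples of [1 / Q],
    the polynomial is, modulo 1 and up to a small error, linear along a short
    progression of step [Q]: indeed [x ^+ l - y ^+ l] is [Q] times the integer
    [i * s l]. *)
Lemma major_arc_phase (p : {poly R}) (d Q N i : nat) (c : R) (x y : int) :
  (size p <= d.+2)%N -> (0 < N)%N -> 0 <= c ->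
  (forall l, (2 <= l)%N -> nearint (Q%:R * p`_l) (c / N%:R ^+ l)) ->
  `|x| <= (3 * N)%N%:Z -> `|y| <= (3 * N)%N%:Z -> x = y + (Q * i)%N%:Z ->
  nearint (p.[x%:~R] - p.[y%:~R] - i%:R * (Q%:R * p`_1))
    ((d * (d.+1 * 3 ^ d.+1))%:R * (c * i%:R / N%:R)).
Proof.
move=> sp N0 c0 hc x3 y3 xy.
have N0R : 0 < N%:R :> R by rewrite ltr0n.
pose s l : int := \sum_(k < l) x ^+ (l.-1 - k) * y ^+ k.
have xyl l : x%:~R ^+ l - y%:~R ^+ l = i%:R * Q%:R * (s l)%:~R :> R.
  rewrite -!rmorphXn -rmorphB /= subrXX intrM {1}xy (addrC y) addrK.
  by rewrite -pmulrn natrM [Q%:R * _]mulrC.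
have sle l : `|(s l)%:~R| <= l%:R * (3 * N%:R) ^+ l.-1 :> R.
  have bnd (z : int) : `|z| <= (3 * N)%N%:Z -> `|z%:~R| <= 3 * N%:R :> R.
    by rewrite -intr_norm -(ler_int R) -pmulrn natrM.
  rewrite rmorph_sum /=; apply: le_trans (ler_norm_sum _ _ _) _.
  apply: (@le_trans _ _ (\sum_(k < l) (3 * N%:R) ^+ l.-1)).
    apply: ler_sum => k _; rewrite rmorphM !rmorphXn /= normrM !normrX.
    have kl : (k <= l.-1)%N by case: k => k /=; case: (l).
    rewrite -[in leRHS](subnK kl) exprD.
    by rewrite ler_pM ?exprn_ge0 // lerXn2r ?nnegrE ?mulr_ge0 // bnd.
  by rewrite sumr_const card_ord -[leLHS]mulr_natl.
have -> : p.[x%:~R] - p.[y%:~R] - i%:R * (Q%:R * p`_1) =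
    \sum_(l < d) (i%:Z * s l.+2)%:~R * (Q%:R * p`_l.+2).
  rewrite !(horner_coef_wide _ sp) -sumrB 2!big_ord_recl /= !expr0 subrr add0r.
  rewrite /bump /= -mulrBr xyl {1}/s big_ord_recl big_ord0 !expr0 addr0 mulr1.
  rewrite [X in X + _ - _](_ : _ = i%:R * (Q%:R * p`_1)); last by rewrite mulr1; ring.
  rewrite addrAC subrr add0r; apply: eq_bigr => l _.
  by rewrite -mulrBr xyl intrM -pmulrn; ring.
have -> : (d * (d.+1 * 3 ^ d.+1))%:R * (c * i%:R / N%:R) =
    \sum_(l < d) ((d.+1 * 3 ^ d.+1)%:R * (c * i%:R / N%:R)).
  by rewrite sumr_const card_ord -[RHS]mulr_natl natrM -[LHS]mulrA.
apply: nearint_sum => l _.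
have := nearintZ (i%:Z * s l.+2) (hc l.+2 isT); apply: nearint_le.
rewrite intrM -pmulrn normrM normr_nat.
have h : `|(s l.+2)%:~R| <= (d.+1 * 3 ^ d.+1)%:R * N%:R ^+ l.+1 :> R.
  apply: le_trans (sle _) _; rewrite /= exprMn natrM natrX mulrA.
  rewrite ler_wpM2r ?exprn_ge0 // -!natrX -!natrM ler_nat.
  by have := ltn_ord l; move=> ld; rewrite leq_mul ?leq_exp2l // ltnS ltnW.
apply: (@le_trans _ _ (i%:R * ((d.+1 * 3 ^ d.+1)%:R * N%:R ^+ l.+1) * (c / N%:R ^+ l.+2))).
  by rewrite ler_wpM2r ?divr_ge0 ?exprn_ge0 // ler_wpM2l.
rewrite le_eqVlt; apply/orP; left; apply/eqP; rewrite (exprS _ l.+1); field.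
by rewrite expf_neq0 ?gt_eqF.
Qed.

Definition weyl_sum (p : {poly R}) (a : int) (L : nat) : R[i] :=
  \sum_(0 <= j < L) expi p.[(a + j%:Z)%:~R].

(** A large sum over an interval stays large on some progression of step [Q]
    and length [T]. There the phase is almost linear, with slope [Q * p`_1], so
    the sum is close to a geometric one, which is large only if the slope is
    close to an integer. *)
Lemma weyl_sum_linear_coef (p : {poly R}) (d K B N Q L : nat) (a : int) :
  (1 < K)%N -> (K ^ (2 * B + (d * (d.+1 * 3 ^ d.+1)) + 200) <= N)%N ->
  (size p <= d.+2)%N -> (Q <= K ^ B)%N -> `|a| <= N%:Z -> (L <= N)%N ->
  (forall l, (2 <= l)%N -> nearint (Q%:R * p`_l) (K%:R ^+ B / N%:R ^+ l)) ->
  N%:R <= K%:R * normc (weyl_sum p a L) ->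
  nearint (Q%:R * p`_1) (K%:R ^+ (2 * B + (d * (d.+1 * 3 ^ d.+1)) + 200) / N%:R).
Proof.
set D := (d * _)%N => K1 KN sp QK aN LN hl big.
have K0 : (0 < K)%N := ltnW K1.
have N0 : (0 < N)%N by apply: leq_trans KN; rewrite expn_gt0 K0.
have N0R : 0 < N%:R :> R by rewrite ltr0n.
have K0R : 0 < K%:R :> R by rewrite ltr0n.
(* 100 leaves room for the numerical constants below. *)
pose B2 := (B + D + 100)%N.
pose T := (N %/ K ^ B2)%N.
have KB0 : (0 < K ^ B2)%N by rewrite expn_gt0 K0.
have TN : (T * K ^ B2 <= N)%N by apply: leq_trunc_div.
have T0 : (0 < T)%N.
  by rewrite divn_gt0 // (leq_trans _ KN) // leq_exp2l // /B2; clear; lia.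
have NT : (N <= 2 * T * K ^ B2)%N.
  apply: ltnW (leq_trans (ltn_ceil N KB0) _); rewrite leq_mul2r -/T.
  by apply/orP; right; move: T0; clear; lia.
have T0R : 0 < T%:R :> R by rewrite ltr0n.
have powT c b : (c + b <= B2)%N -> (c * (T * K ^ b) <= N)%N.
  move=> cb; apply: leq_trans TN; rewrite mulnCA leq_mul2l; apply/orP; right.
  exact: leq_mul_expn.
have QT : (4 * (K * (Q * T)) <= N)%N.
  apply: leq_trans (powT 4%N B.+1 _); last by rewrite /B2; clear; lia.
  have -> : (K * (Q * T) = T * (K * Q))%N by rewrite mulnA mulnC.
  by rewrite expnS !leq_mul2l QK !orbT.
pose g n : R[i] := expi p.[(a + n%:Z)%:~R].
have g1 n : normc (g n) <= 1 by rewrite normc_expi.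
have avg := @shift_average g L T Q g1.
have [j jL hj] : exists2 j, (j < L)%N &
    T%:R <= 4 * K%:R * normc (\sum_(0 <= i < T) g (j + Q * i)%N).
  apply: contrapT => /forall2NP no.
  have le1 : 4 * K%:R * (\sum_(0 <= j < L) normc (\sum_(0 <= i < T) g (j + Q * i)%N)) <=
      N%:R * T%:R.
    apply: (@le_trans _ _ (\sum_(0 <= j < L) T%:R)).
      rewrite big_distrr /= !big_nat; apply: ler_sum => j /andP [_ jL].
      by case: (no j) => // /negP; rewrite -ltNge => /ltW.
    rewrite big_const_nat subn0 iter_addr_0 -[leLHS]mulr_natl ler_wpM2r //.
    by rewrite ler_nat.
  have le2 : 4 * K%:R * (2 * (Q * T)%:R) <= 2 * N%:R :> R.
    by move: QT; rewrite -(ler_nat R) !natrM; lra.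
  have le3 := ler_wpM2l (ltW T0R) le2.
  have le4 := ler_wpM2l (mulr_ge0 (ler0n R 4) (ltW K0R)) avg.
  have le5 := ler_wpM2l (ltW T0R) big.
  have : 0 < T%:R * N%:R :> R by rewrite mulr_gt0.
  rewrite -[\sum_(0 <= j < L) g j]/(weyl_sum p a L) in le4.
  by lra.
pose y := a + j%:Z.
have iQT i : (i < T)%N -> (Q * i <= N)%N.
  move=> iT; apply: (@leq_trans (Q * T)); first by rewrite leq_mul2l ltnW ?orbT.
  apply: leq_trans QT; rewrite mulnA leq_pmull //.
  by rewrite muln_gt0 K0.
have y2 : `|y| <= (2 * N)%N%:Z by rewrite /y; move: aN jL LN; clear; lia.
pose e := (D%:R * (K%:R ^+ B * T%:R / N%:R) : R).
have e8 : 64 * K%:R * e <= 1.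
  have h : (64 * (D * (T * K ^ B.+1)) <= N)%N.
    apply: leq_trans (powT D (B + 7)%N _); last by rewrite /B2; clear; lia.
    rewrite !(mulnCA 64) !leq_mul2l; apply/orP; right; apply/orP; right.
    by apply: leq_mul_expn2 => //; [rewrite (_ : (B + 7 - B.+1 = 6)%N) //|]; clear; lia.
  have -> : 64 * K%:R * e = (64 * (D * (T * K ^ B.+1)))%:R / N%:R.
    by rewrite /e 3!natrM natrX exprS; ring.
  by rewrite ler_pdivrMr // mul1r ler_nat.
have hlin : T%:R <= 8 * K%:R *
    normc (\sum_(0 <= i < T) expi (p.[y%:~R] + i%:R * (Q%:R * p`_1))).
  have cmp : normc (\sum_(0 <= i < T) g (j + Q * i)%N -
      \sum_(0 <= i < T) expi (p.[y%:~R] + i%:R * (Q%:R * p`_1))) <= T%:R * (8 * e).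
    rewrite -sumrB; apply: le_trans (normc_sum _ _ _) _.
    apply: (@le_trans _ _ (\sum_(0 <= i < T) (8 * e))); last first.
      by rewrite big_const_nat subn0 iter_addr_0 -[leLHS]mulr_natl.
    rewrite !big_nat; apply: ler_sum => i /andP [_ iT].
    apply: nearint_expi; rewrite opprD addrA.
    have := @major_arc_phase p d Q N i (K%:R ^+ B) (a + (j + Q * i)%N%:Z) y sp N0.
    rewrite exprn_ge0 // => /(_ isT hl) H.
    have {}H := H _ _ _; apply: nearint_le (H _ _ _).
    - rewrite -/D ler_wpM2l // ler_wpM2r ?invr_ge0 // ler_wpM2l ?exprn_ge0 //.
      by rewrite ler_nat ltnW.
    - by move: (iQT _ iT) y2; rewrite /y; move: (Q * i)%N jL LN aN; clear; lia.
    - by move: y2; clear; lia.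
    - by rewrite /y PoszD addrA.
  have := normc_triB (\sum_(0 <= i < T) g (j + Q * i)%N) (\sum_(0 <= i < T) g (j + Q * i)%N -
      \sum_(0 <= i < T) expi (p.[y%:~R] + i%:R * (Q%:R * p`_1))).
  rewrite subKr => tri.
  have le1 := ler_wpM2l (ltW T0R) e8.
  have le2 := ler_wpM2l (ltW K0R) cmp.
  have le3 := ler_wpM2l (ltW K0R) tri.
  by lra.
apply: nearint_expiB1.
have := geometric_sum p.[y%:~R] (Q%:R * p`_1) T.
set G := normc (\sum_(0 <= i < T) _) in hlin *; set X := normc _ => XG.
have X0 : 0 <= X by apply: normc_ge0.
have XT : X * T%:R <= 16 * K%:R.
  have := ler_wpM2l X0 hlin; have := ler_wpM2l (ltW K0R) XG; lra.
rewrite ler_pdivlMr //.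
have le1 : X * N%:R <= 32 * K%:R ^+ B2.+1.
  have : X * N%:R <= X * (2 * T * K ^ B2)%:R by rewrite ler_wpM2l // ler_nat.
  rewrite natrM natrM natrX exprS.
  have := ler_wpM2r (exprn_ge0 B2 (ltW K0R)) XT; lra.
apply: le_trans le1 _; rewrite -!natrX -natrM ler_nat.
by apply: leq_mul_expn => //; rewrite /B2; clear; lia.
Qed.

End ExponentialSums.

(** * The inverse theorem in one variable *)
Section WeylOneDim.
Context {R : realType}.

(** By [van_der_corput], a large sum for [p] gives large sums for [pshift p h]
    for many shifts [h]. *)
Lemma popular_shifts (p : {poly R}) (K N L : nat) (a : int) :
  (1 < K)%N -> (K ^ 5 <= N)%N -> (L <= N)%N ->
  N%:R <= K%:R * normc (weyl_sum p a L) ->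
  exists H : seq nat, [/\ uniq H, {in H, forall h, (h < N)%N},
    (N <= 8 * K ^ 2 * size H)%N &
    {in H, forall h, N%:R <= (8 * K ^ 2)%:R *
       normc (weyl_sum (pshift p h.+1%:R) a (L - h.+1))}].
Proof.
move=> K1 KN LN big.
have K0 : (0 < K)%N := ltnW K1.
have N0 : (0 < N)%N by apply: leq_trans KN; rewrite expn_gt0 K0.
have N0R : 0 < N%:R :> R by rewrite ltr0n.
have K0R : 0 < K%:R :> R by rewrite ltr0n.
have K2R : 0 < K%:R ^+ 2 :> R by rewrite exprn_gt0.
pose w h := normc (weyl_sum (pshift p h.+1%:R) a (L - h.+1)).
have vdc := van_der_corput (fun j => p.[(a + j%:Z)%:~R]) LN.
have vdc' : normc (weyl_sum p a L) ^+ 2 <= L%:R + 2 * \sum_(h <- iota 0 N) w h.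
  apply: le_trans vdc _; rewrite lerD2l ler_wpM2l // /index_iota subn0.
  apply: ler_sum => h _; rewrite /w /weyl_sum.
  rewrite (eq_bigr (fun j => expi (pshift p h.+1%:R).[(a + j%:Z)%:~R])) //.
  by move=> j _; rewrite pshiftE -[h.+1%:R]/(h.+1%:Z%:~R) -intrD PoszD addrA.
pose c : R := N%:R / (8 * K%:R ^+ 2).
have c0 : 0 <= c by rewrite divr_ge0 ?mulr_ge0 ?exprn_ge0.
have cK : 8 * K%:R ^+ 2 * c = N%:R.
  by rewrite /c mulrC divfK // mulf_neq0 // gt_eqF.
have wX h : w h <= N%:R.
  rewrite /w; apply: le_trans (normc_sum_expi_le _ _) _.
  by rewrite ler_nat size_iota; move: LN; clear; lia.
have key : 2 * c * (size (iota 0 N))%:R <= \sum_(h <- iota 0 N) w h.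
  rewrite size_iota -(ler_pM2l K2R).
  have sq : N%:R ^+ 2 <= K%:R ^+ 2 * normc (weyl_sum p a L) ^+ 2.
    by rewrite -exprMn lerXn2r ?nnegrE ?mulr_ge0 ?normc_ge0 ?ler0n.
  have le1 := ler_wpM2l (ltW K2R) vdc'.
  have LNR : L%:R <= N%:R :> R by rewrite ler_nat.
  have le2 := ler_wpM2l (ltW K2R) LNR.
  have le3 : 4 * K%:R ^+ 2 <= N%:R :> R.
    by rewrite -natrX -natrM ler_nat; apply: leq_trans KN; apply: leq_mul_expn2.
  have le4 := ler_wpM2r (ltW N0R) le3.
  have le5 : 2 * c * N%:R * K%:R ^+ 2 * 4 = N%:R ^+ 2.
    by rewrite [N%:R ^+ 2]expr2 -{2}cK; ring.
  rewrite [N%:R ^+ 2]expr2 in sq le5; have le6 := le_trans sq le1.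
  by have := mulr_ge0 (ltW N0R) (ltW N0R); lra.
have := popular_values c0 wX key; set H := [seq h <- _ | _].
rewrite size_iota [c * _]mulrC ler_pM2l // => hH.
have toN (s : R) : c <= s -> N%:R <= (8 * K ^ 2)%:R * s.
  move=> cs; rewrite natrM natrX -cK ler_wpM2l //.
exists H; split.
- by rewrite filter_uniq // iota_uniq.
- by move=> h; rewrite mem_filter mem_iota => /andP [_].
- by rewrite -(ler_nat R) natrM; apply: toN.
- by move=> h; rewrite mem_filter => /andP [/toN].
Qed.

(** Induction on the degree. For many shifts [h], the induction hypothesis
    controls the linear coefficient [p^`().[h] - p`_1] of [pshift p h]; by
    [recurrence_poly], applied to this polynomial in [h], the coefficients of
    [p] of index at least 2 are controlled, and [weyl_sum_linear_coef] deals
    with the remaining one. If [N] is smaller than a fixed power of [K] the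
    conclusion is trivial. *)
Lemma weyl_1d d : exists A : nat, forall (K N L : nat) (p : {poly R}) (a : int),
  (1 < K)%N -> (0 < N)%N -> (size p <= d.+1)%N -> `|a| <= N%:Z -> (L <= N)%N ->
  N%:R <= K%:R * normc (weyl_sum p a L) ->
  exists2 q, (0 < q <= K ^ A)%N &
    forall j, (1 <= j)%N -> nearint (q%:R * p`_j) (K%:R ^+ A / N%:R ^+ j).
Proof.
elim: d => [|d [A IH]].
  exists 0%N => K N L p a _ N0 sp _ _ _; exists 1%N => // j j1.
  by rewrite (leq_sizeP _ _ sp) // mulr0; exists 0; rewrite subr0 normr0 divr_ge0 ?exprn_ge0.
have [A2 rec] := @recurrence_poly R d.
pose F := (d.+1)`!.
pose b := ((5 * A + 5) * A2 + 5 * A)%N.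
pose B := (b + F)%N.
pose B1 := (2 * B + (d * (d.+1 * 3 ^ d.+1)) + 200)%N.
exists (B1 * d.+2)%N => K N L p a K1 N0 sp aN LN big.
have K0 : (0 < K)%N := ltnW K1.
have k1 : 1 <= K%:R :> R by rewrite ler1n.
have N0R : 0 < N%:R :> R by rewrite ltr0n.
have pj0 j : (d.+2 <= j)%N -> p`_j = 0 by apply/leq_sizeP.
have [KN|NK] := leqP (K ^ B1) N; last first.
  exists 1%N; first by rewrite /= expn_gt0 K0.
  move=> j j1; have [jd|dj] := leqP j d.+1; last first.
    by rewrite pj0 // mulr0; exists 0; rewrite subr0 normr0 divr_ge0 ?exprn_ge0.
  apply: nearint_le (nearint1 _); rewrite ler_pdivlMr ?exprn_gt0 // mul1r.
  rewrite -!natrX ler_nat expnM; apply: (@leq_trans ((K ^ B1) ^ j)%N).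
    by rewrite leq_exp2r // ltnW.
  rewrite leq_exp2l; first exact: leqW.
  exact: leq_ltn_trans N0 NK.
have powN c : (c <= B1)%N -> (K ^ c <= N)%N.
  by move=> cB; apply: leq_trans KN; rewrite leq_exp2l.
have bB1 : (b + 5 <= B1)%N by rewrite /B1 /B; clear; lia.
have KN5 : (K ^ 5 <= N)%N by apply: powN; move: bB1; clear; lia.
have [H [uH bH dH SH]] := popular_shifts K1 KN5 LN big.
have c8 : (8 * K ^ 2 <= K ^ 5)%N by apply: leq_mul_expn2.
have K51 : (1 < K ^ 5)%N by rewrite -(exp1n 5) ltn_exp2r.
have stepH h : h \in H -> exists2 q, (0 < q <= K ^ (5 * A))%N &
    nearint (q%:R * (p^`().[h.+1%:R] - p`_1)) (K%:R ^+ (5 * A) / N%:R).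
  move=> hH; have [] := IH (K ^ 5)%N N (L - h.+1)%N (pshift p h.+1%:R) a K51 N0.
  - exact: size_pshift.
  - by [].
  - by apply: leq_trans LN; apply: leq_subr.
  - apply: le_trans (SH _ hH) _; rewrite ler_wpM2r ?normc_ge0 // ler_nat.
    exact: c8.
  move=> q; rewrite -expnM => qA /(_ 1%N isT); rewrite pshift_coef1 natrX -exprM.
  by exists q.
have K5 : (0 < K ^ (5 * A))%N by rewrite expn_gt0 K0.
have [q qA] := common_witness K5 stepH.
set H' := seq.filter _ H => dH'.
pose r : {poly R} := q%:R *: (p^`() - (p`_1)%:P).
have [] := rec (K ^ (5 * A + 5))%N N (K%:R ^+ (5 * A) / N%:R) r [seq h.+1%:Z | h <- H'].
- by apply: (leq_trans K1); rewrite -{1}[K]expn1 leq_exp2l // addn_gt0 orbT.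
- by rewrite -expnM; apply: powN; move: bB1; rewrite /b; clear; lia.
- rewrite natrX -exprM mulrAC ler_pdivrMr // mul1r -exprD -natrX ler_nat.
  by apply: powN; move: bB1; rewrite /b; clear; lia.
- apply/leq_sizeP => j dj; rewrite coefZ coefB coef_deriv coefC.
  rewrite (pj0 j.+1) // mul0rn.
  by case: j dj => // j _; rewrite subrr mulr0.
- by rewrite map_inj_uniq ?filter_uniq // => x y [].
- by move=> _ /mapP [h + ->]; rewrite mem_filter => /andP [_ /bH]; clear; lia.
- rewrite size_map; apply: leq_trans dH (leq_trans (leq_mul c8 dH') _).
  by rewrite mulnA -expnD [(5 + _)%N]addnC.
- move=> _ /mapP [h + ->]; rewrite mem_filter => /andP [/asboolP hh _].
  by rewrite /r hornerZ hornerD hornerN hornerC.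
move=> q2; rewrite -expnM natrX -exprM => q2A.
rewrite mulrA -exprD -/b => hr.
have c0 : 0 <= K%:R ^+ b / N%:R :> R by rewrite divr_ge0 ?exprn_ge0.
pose Q := (q2 * q * F)%N.
have hQ l : (2 <= l)%N -> nearint (Q%:R * p`_l) (K%:R ^+ B / N%:R ^+ l).
  move=> l2; have := nearint_coef_of_deriv sp c0 hr l2; apply: nearint_le.
  case: l l2 => [//|l] _ /=; rewrite exprS invfM !mulrA ler_wpM2r ?invr_ge0 ?exprn_ge0 //.
  rewrite ler_wpM2r ?invr_ge0 // -!natrX -natrM ler_nat.
  by apply: leq_mul_expn => //; rewrite /B addnC.
have QK : (Q <= K ^ B)%N.
  have bF : (F * K ^ b <= K ^ B)%N by apply: leq_mul_expn => //; rewrite /B; clear; lia.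
  apply: leq_trans bF; rewrite /Q mulnC leq_mul2l /b expnD; apply/orP; right.
  by move: q2A qA => /andP [_ h2] /andP [_ h1]; apply: leq_mul.
have h1 := weyl_sum_linear_coef K1 KN sp QK aN LN hQ big.
exists Q.
  rewrite !muln_gt0 fact_gt0; move: qA q2A => /andP [-> _] /andP [-> _] /=.
  apply: leq_trans QK _; rewrite leq_exp2l //.
  by apply: (@leq_trans B1); [rewrite /B1; clear; lia|apply: leq_pmulr].
have le1 c j : (c <= B1)%N -> K%:R ^+ c / N%:R ^+ j <= K%:R ^+ (B1 * d.+2) / N%:R ^+ j :> R.
  move=> cB; rewrite ler_wpM2r ?invr_ge0 ?exprn_ge0 // ler_weXn2l //.
  by apply: leq_trans cB _; rewrite leq_pmulr.
case=> [//|[|j]] _; first by apply: nearint_le h1; rewrite -[X in _ / X]expr1; apply: le1.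
by apply: nearint_le (hQ j.+2 isT); apply: le1; rewrite /B1; clear; lia.
Qed.

End WeylOneDim.

(** * Slicing a box *)
Section Box.
Context {R : realType} {k d N : nat}.
Notation M := (2 * N).+1.
Notation box := {ffun 'I_k -> 'I_M}.
Notation index := {ffun 'I_k -> 'I_d.+1}.
Implicit Types (b : box) (i : 'I_k) (t : 'I_M) (s : {set 'I_k}).

(** The box is [[-N, N]^k], indexed by ordinals. *)
Definition centered (t : 'I_M) : int := t%:Z - N%:Z.

Definition update b i t : box := [ffun j => if j == i then t else b j].

(** The map [(b, t) |-> (update b i t, b i)] is an involution. This is the
    averaging over lines in direction [i] through the points of the box. *)
Lemma sum_update (V : nmodType) i (F : box -> V) :
  \sum_b \sum_t F (update b i t) = (\sum_b F b) *+ M.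
Proof.
rewrite pair_big /=.
rewrite (reindex (fun p : box * 'I_M => (update p.1 i p.2, p.1 i))) /=; last first.
  exists (fun p : box * 'I_M => (update p.1 i p.2, p.1 i)) => -[b t] _ /=;
  by congr pair; rewrite ?ffunE ?eqxx //; apply/ffunP => j; rewrite !ffunE; case: eqP => // ->.
rewrite (eq_bigr (fun p => F p.1)); last first.
  move=> [b t] _ /=; congr F; apply/ffunP => j; rewrite !ffunE.
  by case: eqP => // ->.
rewrite -(pair_big predT predT (fun b (_ : 'I_M) => F b)) /= -sumrMnl.
by apply: eq_bigr => b _; rewrite sumr_const card_ord.
Qed.

Context (xi : index -> R) (g0 : index).

(** The coefficient, in the variables outside [s], of the monomial with
    exponents [g0]. It is a polynomial in the variables in [s]: the
    whole polynomial for the full set, and the number [xi g0] for the empty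
    set. *)
Definition partial_poly s b : R :=
  \sum_(g : index | [forall i, (i \notin s) ==> (g i == g0 i)])
    xi g * \prod_(i in s) (centered (b i))%:~R ^+ g i.

(** [partial_poly s] as a polynomial in the [i]-th variable. *)
Definition slice s i b : {poly R} :=
  \poly_(j < d.+1)
    \sum_(g : index | [forall l, (l \notin s) ==> (g l == g0 l)] && (g i == j :> nat))
      xi g * \prod_(l in s :\ i) (centered (b l))%:~R ^+ g l.

Lemma size_slice s i b : (size (slice s i b) <= d.+1)%N.
Proof. exact: size_poly. Qed.

Lemma slice_eval s i b t : i \in s ->
  (slice s i b).[(centered t)%:~R] = partial_poly s (update b i t).
Proof.
move=> si; rewrite /slice horner_poly /partial_poly.
rewrite (partition_big (fun g : index => g i) predT) //=.
apply: eq_bigr => j _; rewrite mulr_suml; apply: eq_bigr => g /andP [_ /eqP gj].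
rewrite [in RHS](big_setD1 i) //= ffunE eqxx -gj -mulrA; congr (_ * _).
rewrite mulrC; congr (_ * _); apply: eq_bigr => l; rewrite !inE => /andP [li _].
by rewrite ffunE (negbTE li).
Qed.

Lemma slice_coef s i b : i \in s ->
  (slice s i b)`_(g0 i) = partial_poly (s :\ i) b.
Proof.
move=> si; rewrite coef_poly ltn_ord /partial_poly; apply: eq_bigl => g.
apply/andP/forallP => [[/forallP h /eqP gi] l|h].
  rewrite !inE negb_and negbK; apply/implyP => /orP [/eqP ->|ls].
    by apply/eqP/val_inj.
  by have := h l; rewrite ls.
split; last by have := h i; rewrite !inE eqxx => /eqP ->.
by apply/forallP => l; apply/implyP => ls; have := h l; rewrite !inE (negbTE ls) andbF.
Qed.

Lemma partial_poly0 b : partial_poly finset.set0 b = xi g0.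
Proof.
rewrite /partial_poly (big_pred1 g0) => [|g].
  by rewrite big_set0 mulr1.
apply/forallP/eqP => [h|-> i]; last by rewrite eqxx implybT.
by apply/ffunP => i; have := h i; rewrite inE => /eqP.
Qed.

Lemma card_box : #|{: box}| = (M ^ k)%N.
Proof. by rewrite card_ffun !card_ord. Qed.

Lemma popular_lines (K : nat) i (w : box -> R) :
  (1 < K)%N -> (forall b, w b <= M%:R) ->
  (M * #|{: box}|)%:R <= K%:R * \sum_b w b ->
  exists H : seq box, [/\ uniq H, (#|{: box}| <= K ^ 2 * size H)%N &
    {in H, forall b, M%:R <= (K ^ 2)%:R * w b}].
Proof.
move=> K1 wM big; have K0 : 0 < K%:R :> R by rewrite ltr0n ltnW.
have M0 : 0 < M%:R :> R by rewrite ltr0n.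
pose c : R := M%:R / (2 * K%:R).
have c0 : 0 <= c by rewrite divr_ge0 ?mulr_ge0 ?ler0n.
have cK : 2 * K%:R * c = M%:R by rewrite /c mulrC divfK // mulf_neq0 // gt_eqF.
have key : 2 * c * (size (enum {: box}))%:R <= \sum_(b <- enum {: box}) w b.
  rewrite -cardE big_enum /= -(ler_pM2l K0).
  by apply: le_trans big; rewrite natrM -cK; lra.
have := popular_values c0 wM key; set H := [seq b <- _ | _].
rewrite -cardE => hH; exists H.
have KK : (2 * K <= K ^ 2)%N by rewrite -mulnn leq_mul2r K1 orbT.
split.
- by rewrite filter_uniq // enum_uniq.
- have h : (#|{: box}| <= 2 * K * size H)%N.
    rewrite -(ler_nat R) natrM natrM -(ler_pM2l M0).
    rewrite -{1}cK -[leLHS]mulrA.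
    by apply: le_trans (ler_wpM2l (mulr_ge0 (ler0n R 2) (ltW K0)) hH) _; lra.
  by apply: leq_trans h _; rewrite leq_mul2r KK orbT.
- move=> b; rewrite mem_filter => /andP [cb _]; rewrite -cK.
  apply: (@le_trans _ _ (2 * K%:R * w b)).
    by rewrite ler_wpM2l // mulr_ge0 // ltW.
  rewrite ler_wpM2r ?(le_trans c0) // -natrM ler_nat //.
Qed.

End Box.

(** * Eliminating the variables *)
Section Elimination.
Context {R : realType}.

(** Many points lie on lines in direction [i] that meet [D] often; on such a
    line [recurrence_poly] controls the coefficient of index [g0 i], which is
    [partial_poly xi g0 (s :\ i)]. A common denominator is kept for many
    points. *)
Lemma eliminate_coordinate (k d : nat) : exists A : nat,
  forall (N K Q : nat) (xi : {ffun 'I_k -> 'I_d.+1} -> R) (g0 : {ffun 'I_k -> 'I_d.+1})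
    (e : R) (s : {set 'I_k}) (i : 'I_k) (D : seq {ffun 'I_k -> 'I_(2 * N).+1}),
  (1 < K)%N -> (K ^ A <= (2 * N).+1)%N -> e * K%:R ^+ A <= 1 -> i \in s ->
  uniq D -> (#|{: {ffun 'I_k -> 'I_(2 * N).+1}}| <= K * size D)%N ->
  {in D, forall b, nearint (Q%:R * partial_poly xi g0 s b) e} ->
  exists q, exists D' : seq {ffun 'I_k -> 'I_(2 * N).+1},
    [/\ (0 < q <= K ^ A)%N, uniq D',
     (#|{: {ffun 'I_k -> 'I_(2 * N).+1}}| <= K ^ A * size D')%N &
     {in D', forall b, nearint ((q * Q)%:R * partial_poly xi g0 (s :\ i) b)
       (K%:R ^+ A * e / (2 * N).+1%:R ^+ g0 i)}].
Proof.
have [A rec] := @recurrence_poly R d.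
exists (2 * A + 2)%N => N K Q xi g0 e s i D K1 KM eK si uD dD nD.
set M := (2 * N).+1 in KM D uD dD nD *.
have K0 : (0 < K)%N := ltnW K1.
have k1 : 1 <= K%:R :> R by rewrite ler1n.
have M0 : (0 < M)%N by [].
have e0 : 0 <= e.
  case: D dD nD {uD} => [|b D] dD nD; last exact: nearint_ge0 (nD b (mem_head _ _)).
  by move: dD; rewrite muln0 leqn0 card_box expn_eq0.
pose w b : R := (#|[pred t | update b i t \in D]|)%:R.
have wM b : w b <= M%:R by rewrite ler_nat -[X in (_ <= X)%N]card_ord max_card.
have big : (M * #|{: {ffun 'I_k -> 'I_M}}|)%:R <= K%:R * \sum_b w b.
  have -> : \sum_b w b = (M * size D)%:R.
    rewrite /w -natr_sum; congr _%:R.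
    rewrite (eq_bigr (fun b => \sum_t (update b i t \in D : nat))%N); last first.
      by move=> b _; rewrite -sum1_card big_mkcond.
    rewrite (sum_update i (fun b => (b \in D : nat))) -mulr_natl natn.
    by congr (_ * _)%N; rewrite -(card_uniqP uD) -sum1_card [RHS]big_mkcond.
  by rewrite -natrM ler_nat mulnCA leq_mul2l dD orbT.
have [H [uH dH SH]] := popular_lines i K1 wM big.
have step b : b \in H -> exists2 q, (0 < q <= K ^ (2 * A))%N &
    nearint ((q * Q)%:R * partial_poly xi g0 (s :\ i) b) (K%:R ^+ (2 * A) * e / M%:R ^+ g0 i).
  move=> bH; pose S := [seq centered t | t <- enum [pred t | update b i t \in D]].
  have [] := rec (K ^ 2)%N M e (Q%:R *: slice xi g0 s i b) S.
  - by rewrite -(exp1n 2) ltn_exp2r.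
  - by rewrite -expnM; apply: leq_trans KM; rewrite leq_exp2l // leq_addr.
  - rewrite natrX -exprM; apply: le_trans eK; rewrite ler_wpM2l //.
    by rewrite ler_weXn2l // leq_addr.
  - by apply: leq_trans (size_scale_leq _ _) _; apply: size_slice.
  - rewrite map_inj_uniq ?enum_uniq // => t1 t2 /addIr [] /ord_inj //.
  - move=> _ /mapP [t _ ->]; rewrite /centered.
    by have := ltn_ord t; rewrite /M; clear; lia.
  - by rewrite size_map -cardE -(ler_nat R) natrM; apply: SH.
  - move=> _ /mapP [t + ->]; rewrite mem_enum inE => tD.
    by rewrite hornerZ slice_eval //; apply: nD.
  move=> q; rewrite -expnM => qA /(_ (g0 i)).
  rewrite coefZ slice_coef // natrX -exprM mulrA -natrM; by exists q.
have KA0 : (0 < K ^ (2 * A))%N by rewrite expn_gt0 K0.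
have [q /andP [q0 qA] dH'] := common_witness KA0 step.
exists q, [seq b <- H | `[< nearint ((q * Q)%:R * partial_poly xi g0 (s :\ i) b)
  (K%:R ^+ (2 * A) * e / M%:R ^+ g0 i) >]]; split.
- by rewrite q0; apply: leq_trans qA _; rewrite leq_exp2l // leq_addr.
- exact: filter_uniq.
- apply: leq_trans dH (leq_trans (leq_mul (leqnn _) dH') _).
  by rewrite mulnA -expnD addnC.
- move=> b; rewrite mem_filter => /andP [/asboolP h _]; apply: nearint_le h.
  rewrite ler_wpM2r ?invr_ge0 ?exprn_ge0 // ler_wpM2r // ler_weXn2l //.
  exact: leq_addr.
Qed.

Lemma eliminate_all (k d m : nat) : exists A : nat,
  forall (N K Q : nat) (xi : {ffun 'I_k -> 'I_d.+1} -> R) (g0 : {ffun 'I_k -> 'I_d.+1})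
    (e : R) (s : {set 'I_k}) (D : seq {ffun 'I_k -> 'I_(2 * N).+1}),
  (#|s| = m)%N ->
  (1 < K)%N -> (K ^ A <= (2 * N).+1)%N -> e * K%:R ^+ A <= 1 ->
  uniq D -> (#|{: {ffun 'I_k -> 'I_(2 * N).+1}}| <= K * size D)%N ->
  {in D, forall b, nearint (Q%:R * partial_poly xi g0 s b) e} ->
  exists2 q, (0 < q <= K ^ A)%N & nearint ((q * Q)%:R * xi g0)
    (K%:R ^+ A * e / (2 * N).+1%:R ^+ (\sum_(i in s) g0 i)).
Proof.
elim: m => [|m [A IH]].
  exists 0%N => N K Q xi g0 e s D /eqP; rewrite cards_eq0 => /eqP -> K1 _ _ _ dD nD.
  exists 1%N => //; rewrite mul1n big_set0 !expr0 mul1r divr1.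
  case: D dD nD => [|b D] dD nD; last by have := nD b (mem_head _ _); rewrite partial_poly0.
  by move: dD; rewrite muln0 leqn0 card_box expn_eq0.
have [A1 el] := eliminate_coordinate k d.
pose A' := (A1.+1 * A + A1)%N.
exists A' => N K Q xi g0 e s D sm K1 KM eK uD dD nD.
set M := (2 * N).+1 in KM D uD dD nD *.
have K0 : (0 < K)%N := ltnW K1.
have k1 : 1 <= K%:R :> R by rewrite ler1n.
have M1 : 1 <= M%:R :> R by rewrite ler1n.
have [i si] : exists i, i \in s by apply/set0Pn; rewrite -cards_eq0 sm.
have e0 : 0 <= e.
  case: D dD nD {uD} => [|b D] dD nD; last exact: nearint_ge0 (nD b (mem_head _ _)).
  by move: dD; rewrite muln0 leqn0 card_box expn_eq0.
have KM1 : (K ^ A1 <= M)%N by apply: leq_trans KM; rewrite leq_exp2l // leq_addl.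
have eK1 : e * K%:R ^+ A1 <= 1.
  by apply: le_trans eK; rewrite ler_wpM2l // ler_weXn2l // leq_addl.
have [q [D' [/andP [q0 qA] uD' dD' nD']]] := el N K Q xi g0 e s i D K1 KM1 eK1 si uD dD nD.
have dD2 : (#|{: {ffun 'I_k -> 'I_M}}| <= K ^ A1.+1 * size D')%N.
  by apply: leq_trans dD' _; rewrite leq_mul2r leq_exp2l // leqnSn orbT.
have [] := IH N (K ^ A1.+1)%N (q * Q)%N xi g0 (K%:R ^+ A1 * e / M%:R ^+ g0 i) (s :\ i) D'.
- by move: sm; rewrite (cardsD1 i) si => -[].
- by apply: (leq_trans K1); rewrite -{1}[K]expn1 leq_exp2l.
- by rewrite -expnM; apply: leq_trans KM; rewrite leq_exp2l // leq_addr.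
- rewrite natrX -exprM mulrAC ler_pdivrMr ?exprn_gt0 ?ltr0n // mul1r.
  apply: le_trans (exprn_ege1 _ M1); apply: le_trans eK.
  by rewrite /A' exprD [_ * e]mulrC -mulrA [K%:R ^+ A1 * _]mulrC.
- by [].
- by [].
- by [].
move=> q2 /andP [q20 q2A] h; exists (q2 * q)%N.
  rewrite muln_gt0 q20 q0 /= /A' expnD; apply: leq_mul => //.
  by rewrite expnM.
rewrite -mulnA (big_setD1 i) //=; apply: nearint_le h.
rewrite natrX -exprM /A' !exprD invfM !mulrA.
rewrite le_eqVlt; apply/orP; left; apply/eqP; ring.
Qed.

End Elimination.

(** * The inverse theorem on a box *)
Section WeylBox.
Context {R : realType}.

(** A nonempty order-convex set of ordinals is the interval from its least to
    its greatest element. *)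
Lemma sum_convex_pred (V : nmodType) (M : nat) (P : pred 'I_M) (F : nat -> V) :
  (forall t1 t2 t3 : 'I_M, (t1 <= t2 <= t3)%N -> P t1 -> P t3 -> P t2) ->
  exists a L : nat, (a + L <= M)%N /\
    \sum_(t | P t) F t = \sum_(0 <= j < L) F (a + j)%N.
Proof.
move=> cP; have [[t0 Pt0]|no] := pselect (exists t, P t); last first.
  exists 0%N, 0%N; split=> //; rewrite big_geq // big_pred0 // => t.
  by apply/negP => Pt; apply: no; exists t.
case: (arg_minnP (fun t : 'I_M => t : nat) Pt0) => a Pa amin.
case: (arg_maxnP (fun t : 'I_M => t : nat) Pt0) => c Pc cmax.
have ac : (a <= c)%N by apply: amin.
exists a, (c - a).+1; split; first by rewrite addnS subnKC.
have -> : \sum_(t | P t) F t = \sum_(a <= j < c.+1) F j.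
  rewrite big_geq_mkord (big_ord_widen_cond _ _ _ (ltn_ord c)).
  apply: eq_bigl => t; rewrite ltnS; apply/idP/andP => [Pt|[h1 h2]].
    by split; [apply: amin|apply: cmax].
  by apply: (cP a t c) => //; rewrite h1.
rewrite -{1}[a : nat]add0n big_addn subSn //.
by apply: eq_bigr => j _; rewrite addnC.
Qed.

(** The sum is large on many lines in a direction [i] that occurs in the
    monomial [g0]. On these, [weyl_1d] controls the coefficient of index
    [g0 i]; the constant coefficient of a slice is not accessible, which is why
    [g0 i] has to be positive. The other variables are then eliminated one at a
    time. *)
Lemma weyl_box (k d : nat) : exists A : nat,
  forall (N K : nat) (xi : {ffun 'I_k -> 'I_d.+1} -> R) (g0 : {ffun 'I_k -> 'I_d.+1})
    (Om : pred {ffun 'I_k -> 'I_(2 * N).+1}) (i : 'I_k),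
  (1 < K)%N -> (0 < g0 i)%N ->
  (forall b (t1 t2 t3 : 'I_(2 * N).+1), (t1 <= t2 <= t3)%N ->
     Om (update b i t1) -> Om (update b i t3) -> Om (update b i t2)) ->
  #|{: {ffun 'I_k -> 'I_(2 * N).+1}}|%:R <=
    K%:R * normc (\sum_(b | Om b) expi (partial_poly xi g0 finset.setT b)) ->
  exists2 q, (0 < q <= K ^ A)%N & nearint (q%:R * xi g0)
    (K%:R ^+ A / (2 * N).+1%:R ^+ (\sum_i g0 i)).
Proof.
have [A1 weyl] := @weyl_1d R d.
have [A2 el] := @eliminate_all R k d k.-1.
pose B := ((2 * A1 + 2) * A2 + 2 * A1)%N.
exists (B * (k * d).+1)%N => N K xi g0 Om i K1 gi cO big.
set M := (2 * N).+1 in Om cO big *.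
have K0 : (0 < K)%N := ltnW K1.
have k1 : 1 <= K%:R :> R by rewrite ler1n.
have M0R : 0 < M%:R :> R by rewrite ltr0n.
have M1 : 1 <= M%:R :> R by rewrite ler1n.
have [KM|MK] := leqP (K ^ B) M; last first.
  exists 1%N; first by rewrite /= expn_gt0 K0.
  apply: nearint_le (nearint1 _); rewrite ler_pdivlMr ?exprn_gt0 // mul1r.
  rewrite -!natrX ler_nat expnM; apply: (@leq_trans (M ^ (k * d).+1)%N).
    apply: leq_pexp2l => //.
    apply: leqW; apply: (@leq_trans (\sum_(i < k) d)%N).
      by apply: leq_sum => j _; rewrite -ltnS.
    by rewrite sum_nat_const card_ord.
  by rewrite leq_exp2r // ltnW.
pose w b : R := normc (\sum_(t | Om (update b i t)) expi (partial_poly xi g0 finset.setT (update b i t))).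
have wM b : w b <= M%:R.
  apply: le_trans (normc_sum _ _ _) _.
  under eq_bigr do rewrite normc_expi.
  by rewrite sumr_const ler_nat -[X in (_ <= X)%N]card_ord max_card.
have big' : (M * #|{: {ffun 'I_k -> 'I_M}}|)%:R <= K%:R * \sum_b w b.
  rewrite natrM; apply: le_trans (ler_wpM2l (ltW M0R) big) _.
  rewrite mulrCA ler_wpM2l // mulr_natl -normcMn.
  rewrite [X in normc (X *+ _)]big_mkcond /= -(sum_update i).
  apply: le_trans (normc_sum _ _ _) _; apply: ler_sum => b _.
  by rewrite -big_mkcond.
have [H [uH dH SH]] := popular_lines i K1 wM big'.
have step b : b \in H -> exists2 q, (0 < q <= K ^ (2 * A1))%N &
    nearint (q%:R * partial_poly xi g0 (finset.setT :\ i) b) (K%:R ^+ (2 * A1) / M%:R ^+ g0 i).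
  move=> bH.
  have [a [L [aL E]]] := sum_convex_pred
    (fun t => expi (slice xi g0 finset.setT i b).[(t%:Z - N%:Z)%:~R]) (cO b).
  have [] := weyl (K ^ 2)%N M L (slice xi g0 finset.setT i b) (a%:Z - N%:Z).
  - by rewrite -(exp1n 2) ltn_exp2r.
  - by [].
  - exact: size_slice.
  - by move: aL; rewrite /M; clear; lia.
  - by apply: leq_trans aL; apply: leq_addl.
  - apply: le_trans (SH _ bH) _; rewrite ler_wpM2l // /w /weyl_sum.
    rewrite (eq_bigr (fun t : 'I_M =>
      expi (slice xi g0 finset.setT i b).[(t%:Z - N%:Z)%:~R])); last first.
      by move=> t _; rewrite -slice_eval ?finset.in_setT.
    rewrite E le_eqVlt; apply/orP; left; apply/eqP; congr normc.
    by apply: eq_bigr => j _; rewrite PoszD addrAC.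
  move=> q; rewrite -expnM => qA /(_ _ gi).
  by rewrite slice_coef ?finset.in_setT // natrX -exprM; exists q.
have KA0 : (0 < K ^ (2 * A1))%N by rewrite expn_gt0 K0.
have [q /andP [q0 qA]] := common_witness KA0 step.
set D := seq.filter _ H => dD.
have [] := el N (K ^ (2 * A1 + 2))%N q xi g0 (K%:R ^+ (2 * A1) / M%:R ^+ g0 i)
   (finset.setT :\ i) D.
- have := cardsD1 i finset.setT; rewrite finset.in_setT cardsT card_ord add1n.
  by move=> /(congr1 predn) /= h; exact: esym h.
- by apply: (leq_trans K1); rewrite -{1}[K]expn1 leq_exp2l // addn_gt0 orbT.
- by rewrite -expnM; apply: leq_trans KM; rewrite leq_exp2l // leq_addr.
- rewrite natrX -exprM mulrAC ler_pdivrMr ?exprn_gt0 // mul1r -exprD.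
  apply: (@le_trans _ _ M%:R); last by rewrite -{1}[M%:R]expr1 ler_weXn2l.
  by rewrite -natrX ler_nat addnC.
- exact: filter_uniq.
- apply: leq_trans dH (leq_trans (leq_mul (leqnn _) dD) _).
  by rewrite mulnA -expnD addnC.
- by move=> b; rewrite mem_filter => /andP [/asboolP].
move=> q2 /andP [q20 q2A] h; exists (q2 * q)%N.
  rewrite muln_gt0 q20 q0 /=.
  apply: leq_trans (leq_mul q2A qA) _; rewrite -expnM -expnD leq_exp2l //.
  exact: leq_pmulr.
have -> : (\sum_i g0 i = g0 i + \sum_(j in finset.setT :\ i) g0 j)%N.
  rewrite (eq_bigl (fun j => j \in finset.setT)); last first.
    by move=> j; rewrite finset.in_setT.
  by rewrite (big_setD1 i) ?finset.in_setT.
apply: nearint_le h; rewrite natrX -exprM mulrA -exprD -/B exprD invfM mulrA.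
rewrite ler_wpM2r ?invr_ge0 ?exprn_ge0 // ler_wpM2r ?invr_ge0 ?exprn_ge0 //.
by rewrite ler_weXn2l // leq_pmulr.
Qed.

End WeylBox.

(** * From lattice points to the box *)
Section Lattice.
Context {R : realType} {k : nat}.

Lemma coord_le_enorm (x : 'rV[R]_k) i : `|x 0 i| <= enorm x.
Proof.
rewrite -sqrtr_sqr /enorm ler_sqrt; last by apply: sumr_ge0 => j _; apply: sqr_ge0.
by rewrite (bigD1 i) //= lerDl; apply: sumr_ge0 => j _; apply: sqr_ge0.
Qed.

Lemma enorm_le (x : 'rV[R]_k) (t : R) :
  (0 < k)%N -> (forall i, `|x 0 i| <= t) -> enorm x <= k%:R * t.
Proof.
move=> k0 xt; have t0 : 0 <= t.
  by case: k k0 x xt => // k' _ x /(_ ord0); apply: le_trans.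
have kt0 : 0 <= k%:R * t by rewrite mulr_ge0.
rewrite -(ger0_norm kt0) -sqrtr_sqr /enorm ler_sqrt ?sqr_ge0 //.
apply: (@le_trans _ _ (\sum_(i < k) t ^+ 2)).
  apply: ler_sum => i _; rewrite -(real_normK (num_real (x 0 i))).
  by rewrite lerXn2r ?nnegrE.
rewrite sumr_const card_ord -[leLHS]mulr_natl exprMn ler_wpM2r ?sqr_ge0 //.
by rewrite -natrX ler_nat -mulnn leq_pmulr.
Qed.

Definition box_point (N : nat) (b : {ffun 'I_k -> 'I_(2 * N).+1}) : 'rV[int]_k :=
  \row_i centered (b i).

Lemma box_point_inj N : injective (@box_point N).
Proof.
move=> b b' e; apply/ffunP => i; have := congr1 (fun v : 'rV_k => v 0 i) e.
by rewrite !mxE => /addIr [] /ord_inj.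
Qed.

(** The middle point is the convex combination of the two others with weight
    [(t3 - t2) / (t3 - t1)] on the first. *)
Lemma box_point_axis_convex (Omega : set 'rV[R]_k) N b i (t1 t2 t3 : 'I_(2 * N).+1) :
  convex_set (Omega : set (convex_lmodType 'rV[R]_k)) ->
  (t1 <= t2 <= t3)%N ->
  Omega (realvec (box_point (update b i t1))) -> Omega (realvec (box_point (update b i t3))) ->
  Omega (realvec (box_point (update b i t2))).
Proof.
move=> cO /andP [t12 t23] h1 h3.
have [e13|ne13] := eqVneq (t3 : nat) t1.
  have -> : t2 = t1 by apply/ord_inj/eqP; rewrite eqn_leq t12 andbT -e13.
  by [].
have lt13 : 0 < t3%:R - t1%:R :> R.
  by rewrite subr_gt0 ltr_nat ltn_neqAle eq_sym ne13 (leq_trans t12).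
pose l : R := (t3%:R - t2%:R) / (t3%:R - t1%:R).
have l0 : 0 <= l by rewrite divr_ge0 ?(ltW lt13) // subr_ge0 ler_nat.
have l1 : l <= 1 by rewrite ler_pdivrMr // mul1r lerD2l lerN2 ler_nat.
have := cO _ _ (Itv01 l0 l1) (mem_set h1) (mem_set h3) => /set_mem.
congr Omega; apply/rowP => j; rewrite !mxE /= !ffunE.
case: eqP => _; last by rewrite /unstable.onem; ring.
rewrite /centered !intrD -!pmulrn /unstable.onem /l; field; exact: lt0r_neq0.
Qed.

Lemma box_point_surj N (r : R) (n : 'rV[int]_k) : r <= N%:R ->
  eball r (realvec n) -> exists b, n = @box_point N b.
Proof.
move=> rN nr.
have nN (i : 'I_k) : `|n 0 i| <= N%:Z.
  have h : `|(n 0 i)%:~R| < N%:R :> R.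
    have := coord_le_enorm (realvec n) i; rewrite mxE => h.
    exact: le_lt_trans h (lt_le_trans nr rN).
  by move: h; rewrite -intr_norm pmulrn ltr_int => /ltW.
exists [ffun i => inord (absz (n 0 i + N%:Z))]; apply/rowP => i.
rewrite !mxE ffunE /centered inordK; first by move: (nN i); clear; lia.
by move: (nN i); clear; lia.
Qed.

Lemma sum_lattice_box (Omega : set 'rV[R]_k) N (r : R) (F : 'rV[int]_k -> R[i]) :
  r <= N%:R -> Omega `<=` eball r ->
  \sum_(n \in lattice_points Omega) F n =
  \sum_(b | `[< lattice_points Omega (@box_point N b) >]) F (box_point b).
Proof.
move=> rN Or.
rewrite (fsbigE (map (@box_point N) (enum [pred b | `[< lattice_points Omega (@box_point N b) >]]))).
- rewrite big_map big_enum_cond /=; apply: eq_bigl => b.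
  by apply/andP/asboolP => [[/asboolP]//|h]; split; [apply/asboolP|apply/mem_set].
- by rewrite map_inj_uniq ?enum_uniq //; apply: box_point_inj.
- by move=> _ /= /mapP [b + ->]; rewrite mem_enum => /asboolP.
- move=> n On /negP nn; exfalso; apply: nn.
  have [b nb] := box_point_surj rN (Or _ On).
  apply/mapP; exists b => //; rewrite mem_enum inE /= -nb.
  exact: On.
Qed.

(** Coefficients indexed by exponents at most [d]; the index set then also
    contains multi-indices of degree larger than [d], which get coefficient
    0. *)
Definition box_coef (d : nat) (xi : 'rV[nat]_k -> R) (g : {ffun 'I_k -> 'I_d.+1}) : R :=
  let v := \row_i (g i : nat) in if (0 < mdeg v <= d)%N then xi v else 0.

Lemma polyfun_partial_poly d N (xi : 'rV[nat]_k -> R) (g0 : {ffun 'I_k -> 'I_d.+1})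
    (b : {ffun 'I_k -> 'I_(2 * N).+1}) :
  polyfun d xi (box_point b) = partial_poly (box_coef xi) g0 finset.setT b.
Proof.
pose v (g : {ffun 'I_k -> 'I_d.+1}) : 'rV[nat]_k := \row_i (g i : nat).
have vinj : injective v.
  move=> g g' e; apply/ffunP => i; have := congr1 (fun w : 'rV_k => w 0 i) e.
  by rewrite !mxE => /ord_inj.
rewrite /polyfun (fsbigE (map v (enum [pred g | (0 < mdeg (v g) <= d)%N]))).
- rewrite big_map big_enum_cond /= /partial_poly.
  rewrite [RHS](bigID (fun g => (0 < mdeg (v g) <= d)%N)) /=.
  rewrite [X in _ = _ + X]big1 ?addr0; last first.
    by move=> g /andP [_ /negbTE]; rewrite /box_coef -/(v g) => ->; rewrite mul0r.
  apply: eq_big => [g|g /andP [_ /set_mem gd]].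
    have -> : [forall l, (l \notin finset.setT) ==> (g l == g0 l)] = true.
      by apply/forallP => l; rewrite finset.in_setT.
    rewrite inE /=; case: (boolP (0 < mdeg (v g) <= d)%N) => //= h.
    exact/mem_set.
  rewrite /box_coef -/(v g) (gd : (0 < mdeg (v g) <= d)%N); congr (_ * _); apply: eq_big => [i|i _].
    by rewrite finset.in_setT.
  by rewrite !mxE.
- by rewrite map_inj_uniq ?enum_uniq.
- by move=> _ /= /mapP [g + ->]; rewrite mem_enum.
- move=> g gd /negP ng; exfalso; apply: ng.
  have gi i : (g ord0 i < d.+1)%N.
    case/andP: gd => _; rewrite /mdeg (bigD1 i) //= ltnS; apply: leq_trans.
    exact: leq_addr.
  have gv : g = v [ffun i => inord (g ord0 i)].
    by apply/rowP => i; rewrite !mxE ffunE inordK.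
  by apply/mapP; exists [ffun i => inord (g ord0 i)]; rewrite // mem_enum inE -gv.
Qed.

End Lattice.

(** * Suprema, denominators and cells *)
Section Final.
Context {R : realType} {k : nat}.

Lemma supnorm_ub (Omega : set 'rV[R]_k) (phi : 'rV[int]_k -> R[i]) (N : nat) (r : R) x :
  r <= N%:R -> Omega `<=` eball r -> lattice_points Omega x ->
  normc (phi x) <= supnorm Omega phi.
Proof.
move=> rN Or Ox; apply: ub_le_sup; last by exists x.
exists (\sum_(b : {ffun 'I_k -> 'I_(2 * N).+1}) normc (phi (box_point b))) => _ [y Oy <-].
have [b ->] := box_point_surj rN (Or _ Oy).
by rewrite (bigD1 b) //= lerDl; apply: sumr_ge0 => j _; apply: normc_ge0.
Qed.

Lemma oscillation_ub (Omega : set 'rV[R]_k) (phi : 'rV[int]_k -> R[i]) (N : nat)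
    (r t : R) x y :
  r <= N%:R -> Omega `<=` eball r -> lattice_points Omega x -> lattice_points Omega y ->
  enorm (realvec x - realvec y) <= t ->
  normc (phi x - phi y) <= oscillation Omega phi t.
Proof.
move=> rN Or Ox Oy xy; apply: ub_le_sup; last by exists x, y.
exists (supnorm Omega phi + supnorm Omega phi) => _ [x' [y' [Ox' Oy' _ ->]]].
apply: le_trans (normc_tri _ _) _; rewrite normc_opp.
by rewrite lerD //; apply: supnorm_ub rN Or _.
Qed.

Lemma sup_ge0 (S : set R) : (forall x, S x -> 0 <= x) -> 0 <= sup S.
Proof.
move=> S0; have [hs|/sup_out -> //] := pselect (has_sup S).
by have [[x Sx] ub] := hs; apply: le_trans (S0 _ Sx) (ub_le_sup ub Sx).
Qed.

Lemma supnorm_ge0 (Omega : set 'rV[R]_k) phi : 0 <= supnorm Omega phi.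
Proof. by apply: sup_ge0 => _ [x _ <-]; apply: normc_ge0. Qed.

Lemma oscillation_ge0 (Omega : set 'rV[R]_k) phi t : 0 <= oscillation Omega phi t.
Proof. by apply: sup_ge0 => _ [x [y [_ _ _ ->]]]; apply: normc_ge0. Qed.

(** Two rational approximations of [x], [a / q] and [m / q'], are compared. If
    they are equal then [q] divides [q']; if not, they differ by at least
    [1 / (q * q')], so they cannot both be very close to [x]. *)
Lemma weyl_denominator (x T Y : R) (a q q' : nat) :
  coprime a q -> (0 < q)%N -> (0 < q')%N -> 0 < T ->
  `|x - a%:R / q%:R| <= 1 / q%:R ^+ 2 ->
  nearint (q'%:R * x) (Y / T) -> q'%:R <= Y ->
  Num.min q%:R (T / q%:R) <= 2 * Y.
Proof.
move=> aq q0 q'0 T0 hx [m hm] q'Y.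
have q0R : 0 < q%:R :> R by rewrite ltr0n.
have q'0R : 0 < q'%:R :> R by rewrite ltr0n.
have Y0 : 0 < Y by apply: lt_le_trans q'Y.
have [e|ne] := eqVneq ((q' * a)%N%:Z) (m * q%:Z).
  have qq' : (q %| q')%N.
    rewrite -(Gauss_dvdl _ (_ : coprime q a)); last by rewrite coprime_sym.
    by rewrite -[q]/(absz q%:Z) -[(q' * a)%N]/(absz (q' * a)%N%:Z) -dvdzE e dvdz_mull.
  rewrite ge_min; apply/orP; left; apply: le_trans (_ : q'%:R <= _).
    by rewrite ler_nat dvdn_leq.
  lra.
have h1 : 1 <= `|(q' * a)%:R - m%:~R * q%:R| :> R.
  have -> : (q' * a)%:R - m%:~R * q%:R = ((q' * a)%N%:Z - m * q%:Z)%:~R :> R.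
    by rewrite intrD intrN intrM -!pmulrn.
  rewrite -intr_norm -[1]/(1%:~R) ler_int; move: ne; rewrite -subr_eq0.
  by move: (_ - _) => z; clear; lia.
have h2 : q%:R^-1 <= Y / T + Y / q%:R ^+ 2.
  have -> : q%:R^-1 = 1 / q%:R :> R by rewrite div1r.
  rewrite ler_pdivrMr //; apply: le_trans h1 _.
  have -> : (q' * a)%:R - m%:~R * q%:R =
      ((q'%:R * x - m%:~R) - q'%:R * (x - a%:R / q%:R)) * q%:R.
    by rewrite natrM; field; rewrite gt_eqF.
  rewrite normrM [`|q%:R|]ger0_norm // ler_wpM2r // (le_trans (ler_normB _ _)) //.
  rewrite lerD // normrM [`|q'%:R|]ger0_norm //.
  apply: le_trans (ler_wpM2l (ltW q'0R) hx) _.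
  by rewrite mulrA mulr1 ler_wpM2r // invr_ge0 exprn_ge0.
set ka := Num.min _ _.
have ka0 : 0 < ka by rewrite lt_min q0R divr_gt0.
have ka1 : ka <= q%:R by rewrite ge_min lexx.
have ka2 : ka * q%:R <= T by rewrite -ler_pdivlMr // ge_min lexx orbT.
have h3 : 1 <= Y * q%:R / T + Y / q%:R.
  move: h2; rewrite -(ler_pM2r q0R) mulVf ?gt_eqF // => h2; apply: le_trans h2 _.
  by rewrite le_eqVlt; apply/orP; left; apply/eqP; field; rewrite !gt_eqF.
have h4 : ka * (Y * q%:R / T) <= Y.
  have -> : ka * (Y * q%:R / T) = Y * (ka * q%:R) / T by ring.
  by rewrite ler_pdivrMr // ler_wpM2l // ltW.
have h5 : ka * (Y / q%:R) <= Y.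
  by rewrite mulrA ler_pdivrMr // mulrC ler_wpM2l // ltW.
by have := ler_wpM2l (ltW ka0) h3; lra.
Qed.

(** On each cell [f] is replaced by its value at one point of the cell. *)
Lemma cell_decomposition (I J : finType) (Om : pred I) (lab : I -> J)
    (e f : I -> R[i]) (Sn Dv B : R) :
  0 <= Sn -> 0 <= Dv -> 0 <= B ->
  (forall b, normc (e b) <= 1) ->
  (forall b, Om b -> normc (f b) <= Sn) ->
  (forall b b', Om b -> Om b' -> lab b = lab b' -> normc (f b - f b') <= Dv) ->
  (forall c, normc (\sum_(b | Om b && (lab b == c)) e b) <= B) ->
  normc (\sum_(b | Om b) e b * f b) <= #|J|%:R * (B * Sn) + #|I|%:R * Dv.
Proof.
move=> Sn0 O0 B0 e1 fS fO eB.
rewrite (partition_big lab predT) //=.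
apply: le_trans (normc_sum _ _ _) _.
apply: (@le_trans _ _ (\sum_(c : J) (B * Sn + \sum_(b | Om b && (lab b == c)) Dv))).
  apply: ler_sum => c _.
  have [[b0 /andP [Ob0 /eqP lb0]]|no] := pselect (exists b, Om b && (lab b == c)); last first.
    rewrite !big_pred0 ?normc0 ?addr0 ?mulr_ge0 // => b; apply/negP => hb;
    by apply: no; exists b.
  have -> : \sum_(b | Om b && (lab b == c)) e b * f b =
      (\sum_(b | Om b && (lab b == c)) e b) * f b0 +
      \sum_(b | Om b && (lab b == c)) e b * (f b - f b0).
    by rewrite big_distrl -big_split; apply: eq_bigr => b _ /=; ring.
  apply: le_trans (normc_tri _ _) _; apply: lerD.
    by rewrite normcM ler_pM ?normc_ge0 // fS.
  apply: le_trans (normc_sum _ _ _) _; apply: ler_sum => b /andP [Ob /eqP lb].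
  rewrite normcM -[Dv]mul1r ler_pM ?normc_ge0 // fO //.
  by rewrite lb lb0.
rewrite big_split /= sumr_const mulr_natl lerD2l -(partition_big lab predT) //=.
rewrite sumr_const mulr_natl ler_wpMn2l // max_card //.
Qed.

End Final.

(** * The theorem *)

(** A discrete substitute for convexity, which the cells inherit from the
    lattice points of a convex set. *)
Definition axis_convex (k N : nat) (Om : pred {ffun 'I_k -> 'I_(2 * N).+1}) :=
  forall i b (t1 t2 t3 : 'I_(2 * N).+1), (t1 <= t2 <= t3)%N ->
    Om (update b i t1) -> Om (update b i t3) -> Om (update b i t2).

(** A sum larger than this bound would, by [weyl_box], produce a rational
    approximation of [xi gamma0] that contradicts [weyl_denominator]. *)
Lemma weyl_lattice_sum (R : realType) (k d : nat) : exists A : nat,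
  forall (xi : 'rV[nat]_k -> R) (gamma0 : 'rV[nat]_k) (a q : nat) (N : R) (M K : nat)
    (Om : pred {ffun 'I_k -> 'I_(2 * M).+1}),
  (1 < K)%N -> 0 < N -> N <= (2 * M).+1%:R -> axis_convex Om ->
  (0 < mdeg gamma0 <= d)%N -> (0 < q)%N -> coprime a q ->
  `|xi gamma0 - a%:R / q%:R| <= 1 / q%:R ^+ 2 ->
  2 * K%:R ^+ A < Num.min q%:R (N ^+ mdeg gamma0 / q%:R) ->
  normc (\sum_(b | Om b) expi (polyfun d xi (box_point b))) <=
    ((2 * M).+1 ^ k)%:R / K%:R.
Proof.
have [A wb] := @weyl_box R k d.
exists A => xi gamma0 a q N M K Om K1 N0 NM cO /andP [g0 gd] q0 aq hx kap.
have K0 : 0 < K%:R :> R by rewrite ltr0n ltnW.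
have [//|lt] := leP (normc _) _; exfalso.
pose g : {ffun 'I_k -> 'I_d.+1} := [ffun i => inord (gamma0 ord0 i)].
have gi i : (gamma0 ord0 i < d.+1)%N.
  by move: gd; rewrite /mdeg (bigD1 i) //= ltnS; apply: leq_trans; apply: leq_addr.
have gE i : g i = gamma0 ord0 i :> nat by rewrite ffunE inordK.
have sg : (\sum_i g i = mdeg gamma0)%N by apply: eq_bigr => i _.
have dg : box_coef xi g = xi gamma0.
  rewrite /box_coef; have -> : \row_i (g i : nat) = gamma0 by apply/rowP => i; rewrite !mxE gE.
  by rewrite g0 gd.
have [i gi0] : exists i, (0 < g i)%N.
  apply: contrapT => /forallNP no; move: g0; rewrite -sg big1 // => i _.
  by apply/eqP; rewrite -leqn0 leqNgt; apply/negP; apply: no.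
have [] := wb M K (box_coef xi) g Om i K1 gi0 (cO i).
  rewrite card_box; move: lt; rewrite ltr_pdivrMr // mulrC => /ltW; congr (_ <= _ * normc _).
  by apply: eq_bigr => b _; rewrite (polyfun_partial_poly xi g).
move=> q' /andP [q'0 q'K]; rewrite dg sg => h.
have h' : nearint (q'%:R * xi gamma0) (K%:R ^+ A / N ^+ mdeg gamma0).
  apply: nearint_le h; rewrite ler_wpM2l ?exprn_ge0 // lef_pV2 ?posrE ?exprn_gt0 ?ltr0n //.
  by rewrite lerXn2r ?nnegrE ?ler0n // ltW.
have q'K' : q'%:R <= K%:R ^+ A :> R by rewrite -natrX ler_nat.
have := weyl_denominator aq q0 q'0 (exprn_gt0 _ N0) hx h' q'K'.
by move=> /(lt_le_trans kap); rewrite ltxx.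
Qed.

Theorem theoremA1 (R : realType) (k d : nat) (hk : (0 < k)%N) (hd : (0 < d)%N) :
  exists eps : R, 0 < eps /\
  exists C : R, 0 < C /\
  forall (xi : 'rV[nat]_k -> R) (N : R), 1 < N ->
  forall Omega : set 'rV[R]_k,
    convex_set (Omega : set (convex_lmodType 'rV[R]_k)) ->
    Omega `<=` eball N ->
  forall (phi : 'rV[int]_k -> R[i]) (gamma0 : 'rV[nat]_k),
    (0 < mdeg gamma0 <= d)%N ->
  forall a q : nat, (a < q)%N -> coprime a q ->
    `|xi gamma0 - a%:R / q%:R| <= 1 / q%:R ^+ 2 ->
  let kappa := Num.min q%:R (N ^+ mdeg gamma0 / q%:R) in
  normc (\sum_(n \in lattice_points Omega) expi (polyfun d xi n) * phi n)
  <= C * (N ^+ k * kappa `^ (- eps) * ln (N + 1) * supnorm Omega phi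
          + N ^+ k * oscillation Omega phi (N * kappa `^ (- eps))).
Proof.
have [A wl] := @weyl_lattice_sum R k d.
(* kappa = K ^ E has to exceed 2 * (K ^ k.+1) ^ A for all K >= 2. *)
pose W := (k.+1 * A)%N.
pose E := W.+2.
have E0 : 0 < E%:R :> R by rewrite ltr0n.
pose eps : R := E%:R^-1.
exists eps; split; first by rewrite invr_gt0.
have l20 : 0 < ln 2 :> R by rewrite ln_gt0 // ltr1n.
pose C1 : R := 2 * (30 * k%:R) ^+ k.
pose C2 : R := 5 ^+ k.
have C10 : 0 <= C1 by rewrite mulr_ge0 ?exprn_ge0 ?mulr_ge0.
have C20 : 0 < C2 by rewrite exprn_gt0.
exists ((C1 + 2 * C2) / ln 2 + C2); split.
  by rewrite ltr_wpDl // divr_ge0 ?addr_ge0 ?mulr_ge0 // ltW.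
move=> xi N N1 Omega cO Or phi gamma0 hg a q aq cop hx; cbv zeta.
set kappa := Num.min _ _.
have q0 : (0 < q)%N by apply: leq_ltn_trans aq.
have q0R : 0 < q%:R :> R by rewrite ltr0n.
have N0 : 0 < N by apply: lt_trans N1.
have kap0 : 0 < kappa by rewrite lt_min q0R divr_gt0 // exprn_gt0.
pose K : R := kappa `^ eps.
have K0 : 0 < K by apply: powR_gt0.
have KE : K ^+ E = kappa.
  by rewrite -powR_mulrn ?ltW // -powRrM mulVf ?gt_eqF // powRr1 // ltW.
rewrite powRN -/K.
pose Sn := supnorm Omega phi; pose Os := oscillation Omega phi (N * K^-1).
rewrite -/Sn -/Os.
have Sn0 : 0 <= Sn := supnorm_ge0 _ _.
have Os0 : 0 <= Os := oscillation_ge0 _ _ _.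
pose LL := ln (N + 1); rewrite -/LL.
have l2L : ln 2 <= LL by rewrite ler_ln ?posrE //; lra.
pose X := N ^+ k * K^-1 * Sn.
have N0' : 0 <= N := ltW N0.
have K0' : 0 <= K := ltW K0.
have iK0 : 0 <= K^-1 by rewrite invr_ge0.
have l20' : 0 <= ln 2 :> R := ltW l20.
have LL0 : 0 <= LL := le_trans l20' l2L.
have C20' : 0 <= C2 := ltW C20.
have X0 : 0 <= X by rewrite !mulr_ge0 ?exprn_ge0.
have XL : X <= (N ^+ k * K^-1 * LL * Sn) / ln 2.
  rewrite ler_pdivlMr // [leRHS](_ : _ = X * LL); last by rewrite /X; ring.
  by rewrite ler_wpM2l.
have Y0 : 0 <= N ^+ k * Os by rewrite mulr_ge0 ?exprn_ge0.
have Z0 : 0 <= N ^+ k * K^-1 * LL * Sn.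
  by rewrite !mulr_ge0 ?exprn_ge0.
suff : normc (\sum_(n \in lattice_points Omega) expi (polyfun d xi n) * phi n) <=
    (C1 + 2 * C2) * X + C2 * (N ^+ k * Os).
  move=> /le_trans; apply.
  have := ler_wpM2l (_ : 0 <= C1 + 2 * C2) XL; rewrite addr_ge0 ?mulr_ge0 // => /(_ isT) h.
  have h2 : 0 <= (C1 + 2 * C2) / ln 2 * (N ^+ k * Os).
    by rewrite mulr_ge0 // divr_ge0 ?addr_ge0 ?mulr_ge0.
  have h3 := mulr_ge0 (ltW C20) Z0.
  by rewrite mulrDl mulrDr; lra.
pose M := (Num.truncn N).+1.
have NM : N <= M%:R by apply/ltW/truncnS_gt.
have M2 : (2 * M).+1%:R <= 5 * N.
  have : (Num.truncn N)%:R <= N by rewrite truncn_le ltW.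
  by rewrite /M -natr1 natrM -[(_.+1)%:R]natr1; lra.
have boxN : ((2 * M).+1 ^ k)%:R <= C2 * N ^+ k.
  by rewrite natrX /C2 -exprMn lerXn2r ?nnegrE ?ler0n // mulr_ge0 // ltW.
pose Om : pred {ffun 'I_k -> 'I_(2 * M).+1} := fun b => `[< lattice_points Omega (box_point b) >].
rewrite (sum_lattice_box _ NM Or) (eq_bigl Om) //.
have OmP b : Om b -> lattice_points Omega (box_point b) by move/asboolP.
have Omc : axis_convex Om.
  move=> i b t1 t2 t3 t13 /asboolP h1 /asboolP h3; apply/asboolP.
  exact: box_point_axis_convex cO t13 h1 h3.
have phiS b : Om b -> normc (phi (box_point b)) <= Sn.
  by move=> /OmP; apply: supnorm_ub NM Or.
(* The trivial bound is enough when K is small. *)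
have [K2|K2] := ltP K 2.
  apply: (@le_trans _ _ (C2 * N ^+ k * Sn)).
    apply: le_trans (normc_sum _ _ _) _.
    apply: (@le_trans _ _ (\sum_(b | Om b) Sn)).
      by apply: ler_sum => b Ob; rewrite normcM normc_expi mul1r phiS.
    rewrite sumr_const -[leLHS]mulr_natl ler_wpM2r // (le_trans _ boxN) // ler_nat.
    by rewrite -card_box max_card.
  have h : C2 * N ^+ k * Sn <= 2 * C2 * X.
    rewrite /X; have -> : 2 * C2 * (N ^+ k * K^-1 * Sn) = C2 * N ^+ k * Sn * (2 * K^-1) by ring.
    rewrite ler_peMr ?mulr_ge0 ?exprn_ge0 //.
    by rewrite ler_pdivlMr // mul1r ltW.
  have h1 := mulr_ge0 C10 X0; have h2 := mulr_ge0 (ltW C20) Y0.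
  by lra.
(* Cells of side s := N / (k * K) have diameter at most N * kappa `^ (- eps).
   There are about K ^ k of them; on each one the exponential sum is smaller
   than the trivial bound by a factor K ^ k.+1, which leaves a factor K^-1. *)
have k0R : 0 < k%:R :> R by rewrite ltr0n.
pose s := N / (k%:R * K).
have s0 : 0 < s by rewrite divr_gt0 // mulr_gt0.
pose tr (t : 'I_(2 * M).+1) := Num.truncn (((centered t)%:~R + N) / s).
pose Bn := Num.truncn (2 * k%:R * K).
have zN b i : Om b -> `|(centered (b i))%:~R| < N.
  move=> /OmP /Or bN; apply: le_lt_trans bN.
  have -> : (centered (b i))%:~R = (realvec (box_point b) : 'rV[R]_k) 0 i by rewrite !mxE.
  exact: coord_le_enorm.
have trB b i : Om b -> (tr (b i) < Bn.+1)%N.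
  move=> /(zN b i); rewrite ltr_norml => /andP [_ h]; rewrite ltnS; apply: le_truncn.
  rewrite ler_pdivrMr // /s; have -> : 2 * k%:R * K * (N / (k%:R * K)) = 2 * N.
    by field; rewrite !gt_eqF.
  lra.
pose lab (b : {ffun 'I_k -> 'I_(2 * M).+1}) : {ffun 'I_k -> 'I_Bn.+1} :=
  [ffun i => inord (tr (b i))].
have labE b b' i : Om b -> Om b' -> lab b = lab b' -> tr (b i) = tr (b' i).
  move=> Ob Ob' /ffunP /(_ i); rewrite !ffunE => /(congr1 val) /=.
  by rewrite !inordK // trB.
have trle (t1 t2 : 'I_(2 * M).+1) : (t1 <= t2)%N -> (tr t1 <= tr t2)%N.
  move=> t12; apply: le_truncn; rewrite ler_wpM2r ?invr_ge0 ?(ltW s0) // lerD2r ler_int.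
  by rewrite /centered lerD2r.
pose K1 := Num.truncn K.
have K12 : (2 <= K1)%N by rewrite truncn_ge_nat // ltW.
have K1K : K1%:R <= K by rewrite truncn_le ltW.
have KK1 : K <= 2 * K1%:R.
  have := truncnS_gt K; rewrite -natr1 -/K1 => h.
  have : 1 <= K1%:R :> R by rewrite ler1n ltnW.
  by lra.
pose B : R := ((2 * M).+1 ^ k)%:R / (K1 ^ k.+1)%:R.
have B0 : 0 <= B by rewrite divr_ge0.
have cellB c : normc (\sum_(b | Om b && (lab b == c)) expi (polyfun d xi (box_point b))) <= B.
  apply: (wl xi gamma0 a q N M (K1 ^ k.+1)%N) => //.
  - by rewrite -(exp1n k.+1) ltn_exp2r.
  - by apply: le_trans NM _; rewrite ler_nat -addn1 mul2n -addnn -addnA leq_addr.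
  - move=> i b t1 t2 t3 t13 /andP [m1 /eqP l1] /andP [m3 /eqP l3].
    have m2 := Omc _ _ _ _ _ t13 m1 m3; rewrite m2 -l1 /=; apply/eqP/ffunP => j.
    rewrite !ffunE; congr inord; case: eqP => // ji.
    have := labE _ _ i m1 m3 (etrans l1 (esym l3)); rewrite !ffunE eqxx => e13.
    case/andP: t13 => /trle h1 /trle h2.
    by apply/eqP; rewrite eqn_leq h1 andbT e13.
  - rewrite natrX -exprM -/W -/kappa -KE.
    apply: (@le_lt_trans _ _ (2 * K ^+ W)).
      by rewrite ler_wpM2l // lerXn2r ?nnegrE ?ler0n // ltW.
    rewrite /E !exprS mulrA ltr_pM2r ?exprn_gt0 //.
    by nra.
have osc b b' : Om b -> Om b' -> lab b = lab b' -> normc (phi (box_point b) - phi (box_point b')) <= Os.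
  move=> Ob Ob' ll; apply: (oscillation_ub phi NM Or (OmP _ Ob) (OmP _ Ob')).
  have -> : N * K^-1 = k%:R * s by rewrite /s; field; rewrite !gt_eqF.
  apply: enorm_le => // i; rewrite !mxE.
  have := labE _ _ i Ob Ob' ll; rewrite /tr.
  have := zN _ i Ob; have := zN _ i Ob'; rewrite !ltr_norml.
  move: (centered (b i))%:~R (centered (b' i))%:~R => x y /andP [y1 _] /andP [x1 _] e.
  have tx : 0 <= (x + N) / s by rewrite divr_ge0 ?(ltW s0) //; lra.
  have ty : 0 <= (y + N) / s by rewrite divr_ge0 ?(ltW s0) //; lra.
  have /andP [x2 x3] := truncn_itv tx; have /andP [y2 y3] := truncn_itv ty.
  rewrite e -natr1 in x2 x3; rewrite -natr1 in y3.
  have : `|(x + N) / s - (y + N) / s| <= 1 by rewrite ler_norml; lra.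
  rewrite -mulrBl opprD addrACA subrr addr0 normrM (gtr0_norm (_ : 0 < s^-1)) ?invr_gt0 //.
  by rewrite ler_pdivrMr // mul1r.
apply: le_trans (cell_decomposition Sn0 Os0 B0 _ phiS osc cellB) _.
  by move=> b; rewrite normc_expi.
rewrite !card_ffun !card_ord; apply: lerD; last first.
  by rewrite mulrA ler_wpM2r.
have BnK : (Bn.+1)%:R <= 3 * k%:R * K.
  have h : Bn%:R <= 2 * k%:R * K by rewrite truncn_le !mulr_ge0.
  have : 1 <= k%:R :> R by rewrite ler1n.
  by rewrite -natr1 => k1; nra.
apply: (@le_trans _ _ (C1 * X)); last first.
  rewrite mulrDl lerDl; exact: mulr_ge0 (mulr_ge0 (ler0n _ 2) C20') X0.
have -> : C1 * X = C1 * N ^+ k / K * Sn by rewrite /X !mulrA.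
rewrite [leLHS]mulrA ler_wpM2r //.
have K1k : K ^+ k.+1 <= 2 ^+ k.+1 * (K1 ^ k.+1)%:R.
  by rewrite natrX -exprMn lerXn2r ?nnegrE ?mulr_ge0 ?ler0n // ltW.
have K1k0 : 0 < (K1 ^ k.+1)%:R :> R by rewrite ltr0n expn_gt0 ltnW.
rewrite /B [leLHS]mulrA ler_pdivrMr // natrX.
apply: (@le_trans _ _ ((3 * k%:R * K) ^+ k * (C2 * N ^+ k))).
  by rewrite ler_pM ?exprn_ge0 // lerXn2r ?nnegrE ?ler0n ?mulr_ge0.
have -> : (3 * k%:R * K) ^+ k * (C2 * N ^+ k) =
    (15 * k%:R) ^+ k * N ^+ k * K^-1 * K ^+ k.+1.
  rewrite /C2 exprS (_ : 15 = 3 * 5); last by rewrite -natrM.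
  rewrite !exprMn; field; exact: lt0r_neq0.
have -> : C1 * N ^+ k / K * (K1 ^ k.+1)%:R =
    (15 * k%:R) ^+ k * N ^+ k * K^-1 * (2 ^+ k.+1 * (K1 ^ k.+1)%:R).
  rewrite /C1 (_ : 30 = 2 * 15); last by rewrite -natrM.
  by rewrite -mulrA !exprMn exprS; ring.
by rewrite ler_wpM2l // !mulr_ge0 ?exprn_ge0 ?mulr_ge0.
Qed.
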